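(* Let $p$ be a prime congruent to $5$ or $11$ modulo $12$ and let $k=p+1$. Then $$P[\mathscr{C}_k\theta_H](j)\equiv V^{b_k}_{n_k}(j)\mod p$$ as polynomials in $j$.
   Context: $M_k$ is the $\mathbb{Q}$-vector space of modular forms of weight $k$ for $\mathrm{SL}_2(\mathbb{Z})$ with rational $q$-expansion, $q=e^{2\pi i\tau}$. $E_k=1-\frac{2k}{B_k}\sum_{n\ge1}\bigl(\sum_{d\mid n}d^{k-1}\bigr)q^n$ is the Eisenstein series, $\Delta=\frac{1}{1728}(E_4^3-E_6^2)=q\prod_{n\ge1}(1-q^n)^{24}$, and $j=E_4^3/\Delta$. Every even $k\ge4$ is written uniquely as $k=12n_k+4a_k+6b_k$ with $n_k\in\mathbb{Z}_{\ge0}$, $a_k\in\{0,1,2\}$, $b_k\in\{0,1\}$. For $f\in M_k$, $P[f]\in\mathbb{Q}[j]$ is the unique polynomial (of degree $\le n_k$) with $\frac{f(\tau)}{\Delta(\tau)^{n_k}E_4(\tau)^{a_k}E_6(\tau)^{b_k}}=P[f](j(\tau))$. For a power series $f(q)$ and even $k\ge4$, $\mathscr{C}_kf$ is the unique modular form of weight $k$ for $\mathrm{SL}_2(\mathbb{Z})$ with $\mathscr{C}_kf-f=\mathcal{O}(q^{n_k+1})$. The theta series of the hexagonal lattice is $\theta_H=\sum_{m,n\in\mathbb{Z}}q^{m^2+n^2+mn}$; $P[\mathscr{C}_k\theta_H]$ has integer coefficients. With ${}_2F_1(\alpha,\beta;\gamma;z)=\sum_{n\ge0}\frac{(\alpha)_n(\beta)_n}{(\gamma)_n}\frac{z^n}{n!}$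 and $(x)_n=x(x+1)\cdots(x+n-1)$, $(x)_0=1$, the polynomials $V_n^0(j),V_n^1(j)$ ($n\ge0$) are the unique polynomials of degree $n$ satisfying $$j^n\cdot{}_2F_1\left(-\tfrac{1}{12},\tfrac14;\tfrac23;\tfrac{1728}{j}\right)=V_n^0(j)+\mathcal{O}(1/j),\qquad j^n\cdot{}_2F_1\left(\tfrac{5}{12},\tfrac34;\tfrac23;\tfrac{1728}{j}\right)=V_n^1(j)+\mathcal{O}(1/j),$$ i.e. the polynomial parts of these expansions in $1/j$. Congruence of polynomials with $p$-integral coefficients means coefficientwise congruence modulo $p$. *)

(* Defs.v *)
From HB Require Import structures.
From mathcomp Require Import all_boot all_order all_algebra.
From mathcomp Require Import finmap.
From mathcomp Require Import all_classical all_reals all_analysis.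
From mathcomp Require Import complex.

Set Implicit Arguments.
Unset Strict Implicit.
Unset Printing Implicit Defensive.

Import Order.TTheory GRing.Theory Num.Theory.
Import numFieldNormedType.Exports.

Local Open Scope classical_set_scope.
Local Open Scope ring_scope.
Local Open Scope complex_scope.

(** A power series in [q] with rational coefficients is represented by its
    coefficient sequence [nat -> rat].  A function on the upper half plane is a
    total function [R[i] -> R[i]] of which only the values at [tau] with
    [0 < complex.Im tau] matter.  The type [R[i]^o] is [R[i]] as a normed space
    over itself, so that [derivable] on it is complex differentiability. *)

(** [q = exp (2 * pi * i * tau)] *)
Definition qpar (R : realType) (tau : R[i]) : R[i] :=
  (expR (- (2 * pi * complex.Im tau)))%:C *
  (cos (2 * pi * complex.Re tau) +i* sin (2 * pi * complex.Re tau)).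

Definition qterm (R : realType) (c : nat -> rat) (tau : R[i]) (n : nat) :
  R[i]^o := ratr (c n) * qpar tau ^+ n.

Definition qsum (R : realType) (c : nat -> rat) (tau : R[i]) : R[i] :=
  limn (series (qterm c tau)).

Definition has_qexp (R : realType) (f : R[i] -> R[i]) (c : nat -> rat) : Prop :=
  forall tau, 0 < complex.Im tau ->
    series (qterm c tau) @ \oo --> (f tau : R[i]^o).

Definition holomorphic_on_H (R : realType) (f : R[i] -> R[i]) : Prop :=
  forall tau, 0 < complex.Im tau ->
    derivable (f : R[i]^o -> R[i]^o) (tau : R[i]^o) 1.

Definition bounded_at_cusp (R : realType) (f : R[i] -> R[i]) : Prop :=
  exists M Y : R, forall tau, Y < complex.Im tau -> `|f tau| <= M%:C.

Definition SL2Z_modular (R : realType) (k : nat) (f : R[i] -> R[i]) : Prop :=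
  forall a b c d : int, a * d - b * c = 1 ->
  forall tau, 0 < complex.Im tau ->
    f ((a%:~R * tau + b%:~R) / (c%:~R * tau + d%:~R)) =
    (c%:~R * tau + d%:~R) ^+ k * f tau.

Definition modular_form (R : realType) (k : nat) (f : R[i] -> R[i]) : Prop :=
  [/\ holomorphic_on_H f, SL2Z_modular k f & bounded_at_cusp f].

(** [f] belongs to the rational space [M_k], with q-expansion [c]. *)
Definition in_Mk (R : realType) (k : nat) (f : R[i] -> R[i])
    (c : nat -> rat) : Prop :=
  modular_form k f /\ has_qexp f c.

(** [bernoulli_seq n] is [[:: B_0; ...; B_n]], by the recursion
    [\sum_(i < m.+1) 'C(m.+1, i) * B_i = 0] for [m > 0]. *)
Fixpoint bernoulli_seq (n : nat) : seq rat :=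
  if n is m.+1 then
    let s := bernoulli_seq m in
    rcons s (- (m.+2%:R)^-1 * \sum_(i < m.+1) 'C(m.+2, i)%:R * s`_i)
  else [:: 1].

Definition bernoulli_num (n : nat) : rat := (bernoulli_seq n)`_n.

Definition eis_coef (k n : nat) : rat :=
  if n == 0%N then 1
  else - ((2 * k)%:R / bernoulli_num k) *
       (\sum_(d <- divisors n) d ^ k.-1)%N%:R.

Definition Eis (R : realType) (k : nat) (tau : R[i]) : R[i] :=
  qsum (eis_coef k) tau.

Definition Delta (R : realType) (tau : R[i]) : R[i] :=
  (Eis 4 tau ^+ 3 - Eis 6 tau ^+ 2) / 1728%:R.

Definition jinv (R : realType) (tau : R[i]) : R[i] :=
  Eis 4 tau ^+ 3 / Delta tau.

(** For every even [k >= 4] there is exactly one such triple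
    [(n_k, a_k, b_k)]; the boolean [b] is read as [0] or [1]. *)
Definition weight_decomp (k n : nat) (a : 'I_3) (b : bool) : Prop :=
  k = (12 * n + 4 * a + 6 * b)%N.

(** [P = P[f]] for [f] of weight [k = 12 n + 4 a + 6 b].  The equality is one of
    meromorphic functions, so it is asserted away from the zeros of the
    denominator (division by [0] is [0] in the library). *)
Definition is_P_of (R : realType) (n : nat) (a : 'I_3) (b : bool)
    (f : R[i] -> R[i]) (P : {poly rat}) : Prop :=
  (size P <= n.+1)%N /\
  forall tau, 0 < complex.Im tau ->
    let D := Delta tau ^+ n * Eis 4 tau ^+ a * Eis 6 tau ^+ b in
    D != 0 -> f tau / D = (map_poly ratr P).[jinv tau].

(** [f = C_k g] for a power series [g], where [n = n_k]: [f] is a modular form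
    of weight [k] and [f - g = O(q^(n+1))]. *)
Definition is_Ck (R : realType) (k n : nat) (g : nat -> rat)
    (f : R[i] -> R[i]) : Prop :=
  exists2 c : nat -> rat, in_Mk k f c & forall m, (m <= n)%N -> c m = g m.

(** Coefficients of the theta series of the hexagonal lattice.  The set is
    finite, the form being positive definite ([fset_set] of an infinite set
    would be empty). *)
Definition thetaH (N : nat) : rat :=
  #|` fset_set [set x : int * int |
        x.1 ^+ 2 + x.2 ^+ 2 + x.1 * x.2 = N%:Z] |%:R.

(** The Pochhammer symbol [(x)_n] *)
Definition rising (x : rat) (n : nat) : rat := \prod_(i < n) (x + i%:R).

(** The coefficient of [z^n] in [2F1(x, y; w; z)] *)
Definition hyp2F1_coef (x y w : rat) (n : nat) : rat :=
  rising x n * rising y n / rising w n / n`!%:R.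

(** Polynomial part of [j^n * F(1728 / j)] where [F = \sum_m c_m z^m]: the
    power [j^i] comes from the term [m = n - i]. *)
Definition poly_part (c : nat -> rat) (n : nat) : {poly rat} :=
  \poly_(i < n.+1) (c (n - i)%N * 1728%:R ^+ (n - i)).

(** [V_n^0] for [b = false] and [V_n^1] for [b = true] *)
Definition V (b : bool) (n : nat) : {poly rat} :=
  if b then poly_part (hyp2F1_coef (5%:R / 12%:R) (3%:R / 4%:R) (2%:R / 3%:R)) n
  else poly_part (hyp2F1_coef (- (1 / 12%:R)) (1 / 4%:R) (2%:R / 3%:R)) n.

Definition p_integral (p : nat) (r : rat) : bool := ~~ (p%:Z %| denq r)%Z.

(** Congruence in [Z_(p)[j]].  For [r] in [Z_(p)], membership in [p Z_(p)] is
    divisibility of the numerator by [p]. *)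
Definition poly_congr (p : nat) (P Q : {poly rat}) : Prop :=
  [/\ forall i, p_integral p P`_i, forall i, p_integral p Q`_i &
      forall i, (p%:Z %| numq (P`_i - Q`_i)%R)%Z].

(* Main.v *)
(** Put [t = Delta / E4^3 = 1 / j].  The theta series [theta] is a root of the
    3-division polynomial of the universal elliptic curve,
    [27 theta^8 - 18 theta^4 E4 - 8 theta^2 E6 - E4^2 = 0], whence
    [theta = E4^(1/4) 2F1(-1/12, 1/4; 2/3; 1728 t)].  So, for [p + 1 = 12 n],
    [theta / Delta^n = j^n 2F1(...) E4^(-p/4)], where [E4^(-p/4) = 1 + O(q^p)]
    modulo [p]; the case [p + 1 = 12 n + 6] follows with Euler's transformation.
    The fractional powers are avoided by comparing [theta] and
    [E6^b \sum_m v_m 1728^m E4^(3(n-m)) Delta^m] through the hypergeometric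
    differential equation, written with [D = q d/dq]: both solve it modulo [p] up
    to [q^n], and its indicial polynomial [m (m - 1/3)] has no root modulo [p] for
    [0 < m <= n].

    The division polynomial is obtained by differentiation: Ramanujan's system for
    [E2, E4, E6], [2 theta^2 = 3 E2(q^3) - E2] and
    [10 theta^4 = 9 E4(q^3) + E4] give a linear homogeneous differential equation
    for the left-hand side, whose only solution without constant term is 0.  All
    of these are convolution identities for divisor sums; they come from one
    Euclidean step on the solutions of [a x + b y = n].  The formula
    [theta = 1 + 6 \sum_n \sum_(d | n) chi_3(d) q^n] is the arithmetic of the
    Eisenstein integers.  The polynomial [P] is read off from the behaviour of
    [f] on the imaginary axis near the cusp. *)

Require Import Defs.
From HB Require Import structures.
From mathcomp Require Import all_boot all_order all_algebra all_field.
From mathcomp Require Import finmap.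
From mathcomp Require Import all_classical all_reals all_analysis.
From mathcomp Require Import complex.
From mathcomp Require Import zify ring lra.

Import Order.TTheory GRing.Theory Num.Theory.
Import numFieldNormedType.Exports.

Local Open Scope ring_scope.
Local Open Scope complex_scope.

Set Implicit Arguments.
Unset Strict Implicit.
Unset Printing Implicit Defensive.

(** * Formal power series *)

(** A series of weight 1 is comparable with a form of weight [p + 1] because [12 n + 6 b] is
    congruent to 1 modulo [p]: under derivations a weight enters only through its residue. In the
    variable [z = 1728 t] one has [D z = z E6 / E4] and [1 - z = E6^2 / E4^3], so the hypergeometric
    operator, conjugated by [E4^(1/4)] and cleared of denominators, has polynomials in [E2], [E4],
    [E6] as coefficients and acts on power series. The same relations explain the factor [E6^b]:
    Euler's transformation multiplies by [(1 - z)^(1/2) = E6 / E4^(3/2)]. The series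
    [E6^b E4^(3(n-m)) Delta^m] begin with [q^m], so the coefficients of [P] and of [V] are the
    unknowns of a unitriangular system. A congruence up to [q^n], which is as far as the form agrees
    with [theta], is therefore enough. [P] is given by values of functions away from the zeros of a
    denominator. These values become identities of coefficients through real asymptotic expansions
    as [q] tends to [0+], where [E4], [E6] and [Delta] are positive. *)

Record fps (R : Type) := Fps { fcoef : nat -> R }.

HB.instance Definition _ (R : Type) := gen_eqMixin (fps R).
HB.instance Definition _ (R : Type) := gen_choiceMixin (fps R).

Lemma fpsP (R : Type) (x y : fps R) : fcoef x =1 fcoef y -> x = y.
Proof. by case: x y => [x] [y] /= /funext ->. Qed.

Section FpsRing.
Variable R : comNzRingType.
Implicit Types x y z : fps R.

Definition fps_zero : fps R := Fps (fun=> 0).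
Definition fps_one : fps R := Fps (fun n => (n == 0)%:R).
Definition fps_opp x : fps R := Fps (fun n => - fcoef x n).
Definition fps_add x y : fps R := Fps (fun n => fcoef x n + fcoef y n).
Definition fps_mul x y : fps R :=
  Fps (fun n => \sum_(i < n.+1) fcoef x i * fcoef y (n - i)).

Definition fps_trunc (N : nat) x : {poly R} := \poly_(i < N) fcoef x i.

Lemma coef_fps_trunc N x i : (i < N)%N -> (fps_trunc N x)`_i = fcoef x i.
Proof. by rewrite coef_poly => ->. Qed.

(** In low degree the Cauchy product is a product of polynomials, so commutativity and associativity
    are inherited from [{poly R}]. *)
Lemma coef_trunc_mul N x y i : (i < N)%N ->
  (fps_trunc N x * fps_trunc N y)`_i = fcoef (fps_mul x y) i.
Proof.
move=> iN; rewrite coefM /=; apply: eq_bigr => j _.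
by rewrite !coef_fps_trunc //; have := ltn_ord j; lia.
Qed.

Lemma fps_addA : associative fps_add.
Proof. by move=> x y z; apply: fpsP => n /=; rewrite addrA. Qed.
Lemma fps_addC : commutative fps_add.
Proof. by move=> x y; apply: fpsP => n /=; rewrite addrC. Qed.
Lemma fps_add0 : left_id fps_zero fps_add.
Proof. by move=> x; apply: fpsP => n /=; rewrite add0r. Qed.
Lemma fps_addN : left_inverse fps_zero fps_opp fps_add.
Proof. by move=> x; apply: fpsP => n /=; rewrite addNr. Qed.

HB.instance Definition _ :=
  GRing.isZmodule.Build (fps R) fps_addA fps_addC fps_add0 fps_addN.

Lemma fps_mulC : commutative fps_mul.
Proof.
move=> x y; apply: fpsP => n.
by rewrite -(coef_trunc_mul _ _ (ltnSn n)) mulrC coef_trunc_mul.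
Qed.
Lemma fps_mulA : associative fps_mul.
Proof.
move=> x y z; apply: fpsP => n.
have H u v w : (fps_trunc n.+1 u * (fps_trunc n.+1 v * fps_trunc n.+1 w))`_n =
    fcoef (fps_mul u (fps_mul v w)) n.
  rewrite coefM /=; apply: eq_bigr => i _.
  by rewrite coef_fps_trunc // coef_trunc_mul // ltnS leq_subr.
by rewrite -H mulrA mulrC H fps_mulC.
Qed.
Lemma fps_mul1 : left_id fps_one fps_mul.
Proof.
move=> x; apply: fpsP => n /=; rewrite big_ord_recl /= mul1r subn0 big1 ?addr0 //.
by move=> i _; rewrite mul0r.
Qed.
Lemma fps_mulDl : left_distributive fps_mul fps_add.
Proof.
move=> x y z; apply: fpsP => n /=; rewrite -big_split /=.
by apply: eq_bigr => i _; rewrite mulrDl.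
Qed.
Lemma fps_1_neq0 : fps_one != fps_zero.
Proof. by apply/eqP => /(congr1 (fun x => fcoef x 0)) /= /eqP; rewrite oner_eq0. Qed.

HB.instance Definition _ := GRing.Zmodule_isComNzRing.Build (fps R)
  fps_mulA fps_mulC fps_mul1 fps_mulDl fps_1_neq0.

Lemma fcoefD x y n : fcoef (x + y) n = fcoef x n + fcoef y n. Proof. by []. Qed.
Lemma fcoefN x n : fcoef (- x) n = - fcoef x n. Proof. by []. Qed.
Lemma fcoefB x y n : fcoef (x - y) n = fcoef x n - fcoef y n. Proof. by []. Qed.
Lemma fcoef0 n : fcoef (0 : fps R) n = 0. Proof. by []. Qed.
Lemma fcoef1 n : fcoef (1 : fps R) n = (n == 0)%:R. Proof. by []. Qed.
Lemma fcoefM x y n :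
  fcoef (x * y) n = \sum_(i < n.+1) fcoef x i * fcoef y (n - i).
Proof. by []. Qed.
Lemma fcoefMn x k n : fcoef (x *+ k) n = fcoef x n *+ k.
Proof. by elim: k => // k IH; rewrite !mulrS fcoefD IH. Qed.
Lemma fcoef_sum I (r : seq I) (P : pred I) (F : I -> fps R) n :
  fcoef (\sum_(i <- r | P i) F i) n = \sum_(i <- r | P i) fcoef (F i) n.
Proof. exact: (big_morph (fun x => fcoef x n)). Qed.
Lemma fcoefM0 x y : fcoef (x * y) 0 = fcoef x 0 * fcoef y 0.
Proof. by rewrite fcoefM big_ord1. Qed.
Lemma fcoefX0 x k : fcoef (x ^+ k) 0 = fcoef x 0 ^+ k.
Proof. by elim: k => // k IH; rewrite !exprS fcoefM0 IH. Qed.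

Definition fpsC (c : R) : fps R := Fps (fun n => if n == 0 then c else 0).

Lemma fpsCM c x n : fcoef (fpsC c * x) n = c * fcoef x n.
Proof.
rewrite fcoefM big_ord_recl /= subn0 big1 ?addr0 //.
by move=> i _; rewrite mul0r.
Qed.

Lemma fcoef_natM k x n : fcoef (k%:R * x) n = k%:R * fcoef x n.
Proof. by rewrite mulr_natl fcoefMn mulr_natl. Qed.

(** The derivation [q d/dq]: coefficients are not shifted. *)
Definition fderiv x : fps R := Fps (fun n => fcoef x n *+ n).

Lemma fderivD x y : fderiv (x + y) = fderiv x + fderiv y.
Proof. by apply: fpsP => n /=; rewrite mulrnDl. Qed.
Lemma fderivN x : fderiv (- x) = - fderiv x.
Proof. by apply: fpsP => n /=; rewrite mulNrn. Qed.
Lemma fderivB x y : fderiv (x - y) = fderiv x - fderiv y.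
Proof. by rewrite fderivD fderivN. Qed.
Lemma fderivM x y : fderiv (x * y) = fderiv x * y + x * fderiv y.
Proof.
apply: fpsP => n; rewrite fcoefD !fcoefM /= -sumrMnl.
rewrite -big_split /=; apply: eq_bigr => i _.
by rewrite mulrnAl mulrnAr -mulrnDr subnKC // -ltnS.
Qed.
Lemma fderiv_nat k : fderiv k%:R = 0.
Proof. by apply: fpsP => n /=; rewrite fcoefMn fcoef1; case: n => //= n;
  rewrite mul0rn mul0rn. Qed.
Lemma fderivMn x k : fderiv (x *+ k) = fderiv x *+ k.
Proof. by apply: fpsP => n /=; rewrite !fcoefMn -!mulrnA mulnC. Qed.
Lemma fderivC c : fderiv (fpsC c) = 0.
Proof. by apply: fpsP => -[|n] //=; rewrite mul0rn. Qed.
Lemma fderiv_natM k x : fderiv (k%:R * x) = k%:R * fderiv x.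
Proof. by rewrite !mulr_natl fderivMn. Qed.
(** The factor [x] avoids the exponent [k - 1], so that [k = 0] is no exception. *)
Lemma fderivX x k : fderiv (x ^+ k) * x = k%:R * x ^+ k * fderiv x.
Proof.
elim: k => [|k IH]; first by rewrite expr0 -[1]/(1%:R) fderiv_nat; ring.
by rewrite exprS fderivM mulrDl -[x * _ * x]mulrA IH -natr1; ring.
Qed.

(** The substitution of [q^k] for [q]. *)
Definition fdilate (k : nat) x : fps R :=
  Fps (fun n => if (k %| n)%N then fcoef x (n %/ k) else 0).

Lemma fcoef_deriv x n : fcoef (fderiv x) n = fcoef x n *+ n. Proof. by []. Qed.
Lemma fcoef_dilate k x n :
  fcoef (fdilate k x) n = if (k %| n)%N then fcoef x (n %/ k) else 0.
Proof. by []. Qed.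

End FpsRing.

Arguments fcoef {R} f n : simpl never.
Global Opaque fps_add fps_mul fps_opp fps_one fps_zero.

(** * Sums over the solutions of [a x + b y = n] *)

(** The maps need to be inverse to each other only on the selected indices, because those used below
    involve truncated subtraction and division. *)
Lemma big_bij (V : nmodType) (I J : eqType) (r : seq I) (s : seq J)
    (P : pred I) (Q : pred J) (h : I -> J) (h' : J -> I)
    (F : I -> V) (G : J -> V) :
    uniq r -> uniq s ->
    (forall i, i \in r -> P i ->
       [/\ h i \in s, Q (h i), h' (h i) = i & F i = G (h i)]) ->
    (forall j, j \in s -> Q j -> [/\ h' j \in r, P (h' j) & h (h' j) = j]) ->
  \sum_(i <- r | P i) F i = \sum_(j <- s | Q j) G j.
Proof.
move=> ur us hP hQ; rewrite -big_filter -[RHS]big_filter.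
have pe : perm_eq [seq j <- s | Q j] [seq h i | i <- r & P i].
  apply: uniq_perm; first exact: filter_uniq.
    rewrite map_inj_in_uniq ?filter_uniq // => i j.
    rewrite !mem_filter => /andP[Pi ri] /andP[Pj rj] e.
    have [_ _ <- _] := hP _ ri Pi; have [_ _ <- _] := hP _ rj Pj.
    by rewrite e.
  move=> j; rewrite mem_filter; apply/andP/mapP.
    move=> [Qj sj]; have [rj Pj e] := hQ _ sj Qj.
    by exists (h' j); rewrite ?mem_filter ?Pj.
  move=> [k]; rewrite mem_filter => /andP[Pk rk] ->.
  by have [] := hP _ rk Pk.
rewrite (perm_big _ pe) big_map /= [RHS]big_seq_cond [LHS]big_seq_cond.
apply: eq_bigr => i; rewrite mem_filter andbT => /andP[Pi ri].
by have [] := hP _ ri Pi.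
Qed.

(** Entries are [((a, b), (x, y))]; in a positive solution of [a x + b y = n] no unknown exceeds
    [n]. *)
Definition quads (n : nat) : seq ((nat * nat) * (nat * nat)) :=
  [seq t <- [seq (ab, xy) | ab <- [seq (a, b) | a <- iota 1 n, b <- iota 1 n],
                            xy <- [seq (x, y) | x <- iota 1 n, y <- iota 1 n]]
   | t.1.1 * t.2.1 + t.1.2 * t.2.2 == n]%N.

Lemma uniq_quads n : uniq (quads n).
Proof.
apply: filter_uniq; apply: allpairs_uniq; last by move=> [? ?] [? ?].
  by apply: allpairs_uniq; rewrite ?iota_uniq // => -[? ?] [? ?].
by apply: allpairs_uniq; rewrite ?iota_uniq // => -[? ?] [? ?].
Qed.

Lemma mem_quads n a b x y :
  (((a, b), (x, y)) \in quads n) =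
  [&& 0 < a, 0 < b, 0 < x, 0 < y & a * x + b * y == n]%N.
Proof.
rewrite mem_filter /=; have [e|_] := eqVneq (a * x + b * y)%N n; last first.
  by rewrite !andbF.
rewrite andTb andbT; apply/allpairsP/and4P => /=.
  move=> [[[? ?] [? ?]]] /= [/allpairsP[[? ?]] /= [+ +] [-> ->]].
  move=> + + /allpairsP[[? ?]] /= [+ +] [-> ->] [-> -> -> ->].
  by rewrite !mem_iota; split; lia.
move=> [a0 b0 x0 y0]; exists ((a, b), (x, y)).
have [? ? ? ?] : [/\ a <= n, b <= n, x <= n & y <= n]%N by split; nia.
split=> //=; apply/allpairsP.
  by exists (a, b); rewrite /= !mem_iota; split=> //; lia.
by exists (x, y); rewrite /= !mem_iota; split=> //; lia.
Qed.

Section Quads.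
Variable R : comNzRingType.
Implicit Types (C : rel nat) (F G : nat -> nat -> R).

Definition sumq (n : nat) (C : rel nat) F : R :=
  \sum_(t <- quads n | C t.1.1 t.1.2) F t.1.1 t.1.2.

Lemma eq_sumq n C F G :
    (forall a b, (0 < a)%N -> (0 < b)%N -> C a b -> F a b = G a b) ->
  sumq n C F = sumq n C G.
Proof.
move=> e; rewrite /sumq big_seq_cond [RHS]big_seq_cond; apply: eq_bigr.
move=> [[a b] [x y]] /=; rewrite mem_quads => /andP[/and5P[? ? _ _ _] ?].
exact: e.
Qed.

Lemma sumqD n C F G :
  sumq n C (fun a b => F a b + G a b) = sumq n C F + sumq n C G.
Proof. exact: big_split. Qed.

Lemma sumqN n C F : sumq n C (fun a b => - F a b) = - sumq n C F.
Proof. exact: sumrN. Qed.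

Lemma sumqB n C F G :
  sumq n C (fun a b => F a b - G a b) = sumq n C F - sumq n C G.
Proof. by rewrite sumqD sumqN. Qed.

Lemma sumqZ n C k F : sumq n C (fun a b => k * F a b) = k * sumq n C F.
Proof. by rewrite /sumq mulr_sumr. Qed.

Definition allab : rel nat := fun _ _ => true.
Definition ltab : rel nat := fun a b => (a < b)%N.
Definition gtab : rel nat := fun a b => (b < a)%N.
Definition eqab : rel nat := fun a b => a == b.

Lemma sumq_split n F :
  sumq n allab F = sumq n ltab F + sumq n gtab F + sumq n eqab F.
Proof.
rewrite /sumq (bigID (fun t => t.1.1 < t.1.2)%N) /= -addrA; congr (_ + _).
rewrite (bigID (fun t => t.1.2 < t.1.1)%N) /=; congr (_ + _); apply: eq_bigl.
  by move=> t; rewrite /gtab; lia.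
by move=> t; rewrite /eqab; lia.
Qed.

(* A Euclidean step on [(x, y)]: [a x + b y = a (x - y) + (a + b) y]. *)
Lemma sumq_euclid n F :
  sumq n allab F = sumq n ltab (fun a b => F a (b - a)%N) +
    sumq n gtab (fun a b => F (a - b)%N b) +
    \sum_(d <- divisors n) \sum_(1 <= l < d) F l (d - l)%N.
Proof.
rewrite /sumq (bigID (fun t => t.2.2 < t.2.1)%N) /= -addrA; congr (_ + _).
  apply: (big_bij
    (h := fun t => ((t.1.1, t.1.1 + t.1.2), (t.2.1 - t.2.2, t.2.2))%N)
    (h' := fun t => ((t.1.1, t.1.2 - t.1.1), (t.2.1 + t.2.2, t.2.2))%N)).
  - exact: uniq_quads.
  - exact: uniq_quads.
  - move=> [[a b] [x y]] /=; rewrite !mem_quads /ltab addKn => /and5P[? ? ? ? ?] lt.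
    rewrite subnK; last lia.
    split=> //; last lia.
    by apply/and5P; split; try lia; nia.
  - move=> [[a b] [x y]] /=; rewrite !mem_quads /ltab => /and5P[? ? ? ? ?] lt.
    rewrite addnK subnKC; last lia.
    split=> //; last lia.
    by apply/and5P; split; try lia; nia.
rewrite (bigID (fun t => t.2.1 < t.2.2)%N) /=; congr (_ + _).
  apply: (big_bij
    (h := fun t => ((t.1.1 + t.1.2, t.1.2), (t.2.1, t.2.2 - t.2.1))%N)
    (h' := fun t => ((t.1.1 - t.1.2, t.1.2), (t.2.1, t.2.2 + t.2.1))%N)).
  - exact: uniq_quads.
  - exact: uniq_quads.
  - move=> [[a b] [x y]] /=; rewrite !mem_quads /gtab addnK => /and5P[? ? ? ? ?] lt.
    rewrite subnK; last lia.
    split=> //; last lia.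
    by apply/and5P; split; try lia; nia.
  - move=> [[a b] [x y]] /=; rewrite !mem_quads /gtab => /and5P[? ? ? ? ?] lt.
    rewrite addnK subnK; last lia.
    split=> //; last lia.
    by apply/and5P; split; try lia; nia.
(* On the diagonal [x = y] the equation is [x (a + b) = n]: [d = a + b] is a divisor of [n] and
   [l = a] runs below it. *)
rewrite -(big_allpairs_dep (h := fun d l : nat => (d, l)) (F := fun t => F t.2 (t.1 -
  t.2)%N)) /=.
apply: (big_bij (h := fun t => (t.1.1 + t.1.2, t.1.1)%N)
  (h' := fun t => ((t.2, t.1 - t.2), (n %/ t.1, n %/ t.1))%N)).
- exact: uniq_quads.
- apply: allpairs_uniq_dep; rewrite ?divisors_uniq //.
    by move=> *; apply: iota_uniq.
  by move=> [? ?] [? ?] /= _ _ [-> ->].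
- move=> [[a b] [x y]] /=; rewrite mem_quads => /and5P[a0 b0 x0 y0 /eqP e] H.
  have xy : y = x by lia.
  have n0 : (0 < n)%N by nia.
  have e' : n = (x * (a + b))%N by rewrite -e xy; lia.
  rewrite addKn e' mulnK; last lia.
  split=> //; last by rewrite xy.
  apply/allpairsPdep; exists (a + b)%N, a; split=> //.
    by rewrite -dvdn_divisors ?dvdn_mull // muln_gt0; lia.
  by rewrite mem_index_iota; lia.
- move=> [d l] /allpairsPdep[d' [l' [+ + [-> ->]]]] _ /=.
  rewrite mem_index_iota => dn /andP[l0 ld].
  have n0 : (0 < n)%N by case: (posnP n) dn => // ->; rewrite inE; lia.
  move: dn; rewrite -dvdn_divisors // => /divnK e.
  rewrite (subnKC (ltnW ld)) mem_quads ltnn; split=> //.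
  by apply/and5P; split; nia.
Qed.

(** For [a = b] the equation reads [a (x + y) = n], and [n / a] is a sum of two positive integers in
    [n / a - 1] ways. *)
Lemma sumq_diag n (f : nat -> R) :
  sumq n eqab (fun a _ => f a) =
  \sum_(d <- divisors n) (n %/ d - 1)%:R * f d.
Proof.
transitivity (\sum_(d <- divisors n) \sum_(1 <= l < n %/ d) f d); last first.
  by apply: eq_bigr => d _; rewrite sumr_const_nat mulr_natl.
rewrite -(big_allpairs_dep (h := fun d l : nat => (d, l)) (F := fun t => f t.1)) /=.
apply: (big_bij (h := fun t => (t.1.1, t.2.1)%N)
  (h' := fun t => ((t.1, t.1), (t.2, n %/ t.1 - t.2))%N)).
- exact: uniq_quads.
- apply: allpairs_uniq_dep; rewrite ?divisors_uniq //.
    by move=> *; apply: iota_uniq.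
  by move=> [? ?] [? ?] /= _ _ [-> ->].
- move=> [[a b] [x y]] /=;
    rewrite mem_quads /eqab => /and5P[a0 b0 x0 y0 /eqP e] /eqP ab.
  subst b; have n0 : (0 < n)%N by nia.
  have e' : n = ((x + y) * a)%N by lia.
  rewrite e' mulnK // addKn; split=> //.
  apply/allpairsPdep; exists a, x; split=> //.
    by rewrite -dvdn_divisors ?dvdn_mull // muln_gt0; lia.
  by rewrite mem_index_iota mulnK //; lia.
- move=> [d l] /allpairsPdep[d' [l' [+ + [-> ->]]]] _ /=.
  rewrite mem_index_iota => dn /andP[l0 ld].
  have n0 : (0 < n)%N by case: (posnP n) ld => // ->; rewrite div0n.
  move: dn; rewrite -dvdn_divisors // => /divnK e.
  rewrite mem_quads /eqab eqxx; split=> //.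
  by apply/and5P; split; nia.
Qed.

Definition lambert (f : nat -> R) : fps R :=
  Fps (fun n => if n == 0 then 0 else \sum_(d <- divisors n) f d).

Lemma fcoef_lambert0 f : fcoef (lambert f) 0 = 0. Proof. by []. Qed.

Lemma fcoef_lambert f n : (0 < n)%N ->
  fcoef (lambert f) n = \sum_(d <- divisors n) f d.
Proof. by case: n. Qed.

(** Split [n = i + (n - i)] and write [i = a x], [n - i = b y] for divisors [a] and [b]. *)
Lemma lambertM f g n :
  fcoef (lambert f * lambert g) n = sumq n allab (fun a b => f a * g b).
Proof.
pose F (t : (nat * nat) * (nat * nat)) := f t.1.1 * g t.1.2.
have -> : sumq n allab (fun a b => f a * g b) =
    \sum_(i < n.+1) \sum_(t <- quads n | (t.1.1 * t.2.1 == i)%N) F t.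
  rewrite (exchange_big_dep xpredT) //= /sumq big_seq_cond [RHS]big_seq_cond.
  apply: eq_bigr => -[[a b] [x y]];
    rewrite mem_quads andbT => /and5P[? ? ? ? /= /eqP e].
  have lt : (a * x < n.+1)%N by lia.
  by rewrite (big_pred1 (Ordinal lt)) // => i; rewrite /= eq_sym.
rewrite fcoefM; apply: eq_bigr => -[i /= lt] _.
have [->|i0] := eqVneq i 0%N.
  rewrite fcoef_lambert0 mul0r big1_seq // => -[[a b] [x y]] /=.
  by rewrite mem_quads => /andP[/eqP ? /and5P[? ? ? ? _]]; nia.
have [ni0|ni0] := eqVneq (n - i)%N 0%N.
  rewrite ni0 fcoef_lambert0 mulr0 big1_seq // => -[[a b] [x y]] /=.
  by rewrite mem_quads => /andP[/eqP ? /and5P[? ? ? ? /eqP ?]]; nia.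
transitivity (\sum_(a <- divisors i) \sum_(b <- divisors (n - i)) f a * g b).
  by rewrite !fcoef_lambert ?lt0n // mulr_suml; apply: eq_bigr => a _;
    rewrite mulr_sumr.
rewrite -(big_allpairs_dep (h := fun a b : nat => (a, b)) (F := fun t => f t.1 * g
  t.2)) /=.
apply: esym; apply: (big_bij (h := fun t => t.1)
  (h' := fun t => (t, (i %/ t.1, (n - i) %/ t.2)%N))).
- exact: uniq_quads.
- apply: allpairs_uniq_dep; rewrite ?divisors_uniq // => -[? ?] [? ?] /= _ _ [-> ->] //.
- move=> [[a b] [x y]]; rewrite mem_quads => /and5P[/= a0 b0 x0 y0 /eqP e] /eqP e'.
  have e2 : (n - i = b * y)%N by lia.
  rewrite -e' mulKn // e' e2 mulKn //; split=> //.
  apply/allpairsPdep; exists a, b; split=> //.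
    by rewrite -e' -dvdn_divisors ?muln_gt0 ?a0 // dvdn_mulr.
  by rewrite -dvdn_divisors ?muln_gt0 ?b0 // dvdn_mulr.
- move=> [a b] /allpairsPdep[a' [b' [+ + [-> ->]]]] _ /=.
  rewrite -!dvdn_divisors; [|lia..] => /divnK e1 /divnK e2.
  rewrite mem_quads; split=> //; last by apply/eqP; lia.
  by apply/and5P; split; nia.
Qed.
End Quads.

(** * Liouville's identities *)

Section Liouville.
Variable R : comNzRingType.

(** Replaces a chain of rewritings: given a suitable multiple of a known identity, the goal becomes
    a ring identity. Multiples are passed with [congr1]. *)
Lemma eq_by_sub (x y z t : R) : z = t -> x - y = z - t -> x = y.
Proof. by move=> ->; rewrite subrr => /subr0_eq. Qed.

Definition absdiff (a b : nat) : nat := (a - b + (b - a))%N.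

(** The Euclidean step is applied to [f (a + b)] and to [f a + f b]. Both produce the sum of [f b]
    over [a < b] and of [f a] over [b < a]; eliminating it leaves [f (a + b) - f |a - b|] and
    divisor sums. *)
Lemma liouville1 n (f : nat -> R) :
  sumq n allab (fun a b => f (a + b)%N - f (absdiff a b)) =
  \sum_(d <- divisors n)
    (\sum_(1 <= l < d) (f d + f l + f (d - l)%N) -
     (n %/ d - 1)%:R * (2 * f d + f 0%N)).
Proof.
have E1 := sumq_euclid n (fun a b => f (a + b)%N).
rewrite (@eq_sumq _ n ltab _ (fun a b => f b)) in E1; last first.
  by move=> a b _ _ ab; congr f; rewrite /ltab in ab; lia.
rewrite (@eq_sumq _ n gtab _ (fun a b => f a)) in E1; last first.
  by move=> a b _ _ ab; congr f; rewrite /gtab in ab; lia.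
rewrite (eq_bigr (fun d => \sum_(1 <= l < d) f d)) in E1; last first.
  move=> d _; rewrite !big_nat; apply: eq_bigr => l /andP[_ ld].
  by rewrite subnKC // ltnW.
have E2 := sumq_euclid n (fun a b => f a + f b).
rewrite sumq_split !sumqD in E2.
rewrite [sumq n eqab (fun=> f)](@eq_sumq _ n eqab _ (fun a b => f a)) in E2; last first.
  by move=> a b _ _ /eqP->.
rewrite sumqB [X in _ - X]sumq_split E1.
rewrite (@eq_sumq _ n ltab (fun a b => f (absdiff a b)) (fun a b => f (b - a)%N));
  last first.
  by move=> a b _ _ ab; congr f; rewrite /ltab /absdiff in ab *; lia.
rewrite (@eq_sumq _ n gtab (fun a b => f (absdiff a b)) (fun a b => f (a - b)%N));
  last first.
  by move=> a b _ _ ab; congr f; rewrite /gtab /absdiff in ab *; lia.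
rewrite (@eq_sumq _ n eqab (fun a b => f (absdiff a b)) (fun a b => f 0%N)); last first.
  by move=> a b _ _ /eqP ->; congr f; rewrite /absdiff; lia.
rewrite !sumq_diag in E2 *.
rewrite [in RHS](eq_bigr (fun d => \sum_(1 <= l < d) f d + \sum_(1 <= l < d) (f l + f
  (d - l)%N) -
   ((n %/ d - 1)%:R * f d + (n %/ d - 1)%:R * f d + (n %/ d - 1)%:R * f 0%N)));
     last first.
  move=> d _; under eq_bigr do rewrite -addrA.
  by rewrite big_split /=; ring.
rewrite sumrB !big_split /=.
apply: (eq_by_sub E2).
ring.
Qed.

(** The elimination of the first identity with quadratic weights. The weights [b (a + b)] and
    [a (a + b)] of [E2] are such that the terms weighted by a square, which [E1] creates, disappear
    off the diagonal and only the weight [a b] remains. *)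
Lemma liouville2 n (g : nat -> R) :
  sumq n allab (fun a b => (a * b)%:R *
    (g (a + b)%N + g (absdiff a b) - 2 * g a - 2 * g b)) =
  \sum_(d <- divisors n)
    (\sum_(1 <= l < d) ((l * (d - l))%:R * g d - (d * (d - l))%:R * g l
       - (d * l)%:R * g (d - l)%N) +
     (n %/ d - 1)%:R * (d%:R ^+ 2 * g 0%N)).
Proof.
have E1 := sumq_euclid n (fun a b => (a * b)%:R * g (a + b)%N).
rewrite (@eq_sumq _ n ltab _ (fun a b => a%:R * b%:R * g b - a%:R ^+ 2 * g b)) in E1;
  last first.
  move=> a b _ _; rewrite /ltab => ab; rewrite subnKC ?(ltnW ab) //.
  by rewrite natrM natrB ?(ltnW ab) //; ring.
rewrite (@eq_sumq _ n gtab _ (fun a b => a%:R * b%:R * g a - b%:R ^+ 2 * g a)) in E1;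
  last first.
  move=> a b _ _; rewrite /gtab => ab; rewrite subnK ?(ltnW ab) //.
  by rewrite natrM natrB ?(ltnW ab) //; ring.
have E2 := sumq_euclid n (fun a b => (b * (a + b))%:R * g a + (a * (a + b))%:R * g b).
rewrite (@eq_sumq _ n ltab _ (fun a b => b%:R ^+ 2 * g a - a%:R * b%:R * g a
  + a%:R * b%:R * g (b - a)%N)) in E2; last first.
  move=> a b _ _; rewrite /ltab => ab; rewrite subnKC ?(ltnW ab) //.
  by rewrite !natrM natrB ?(ltnW ab) //; ring.
rewrite (@eq_sumq _ n gtab _ (fun a b => a%:R * b%:R * g (a - b)%N
  + (a%:R ^+ 2 * g b - a%:R * b%:R * g b))) in E2; last first.
  move=> a b _ _; rewrite /gtab => ab; rewrite subnK ?(ltnW ab) //.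
  by rewrite !natrM natrB ?(ltnW ab) //; ring.
pose W a b := a%:R * b%:R * g (a + b)%N + a%:R * b%:R * g (absdiff a b)
   - 2 * (a%:R * b%:R * g a) - 2 * (a%:R * b%:R * g b).
rewrite (@eq_sumq _ n allab _ W); last by move=> a b *; rewrite /W natrM; ring.
rewrite (@eq_sumq _ n allab _ (fun a b => a%:R * b%:R * g (a + b)%N)) in E1; last first.
  by move=> a b *; rewrite natrM.
rewrite (@eq_sumq _ n allab _ (fun a b => b%:R ^+ 2 * g a + a%:R ^+ 2 * g b + 
  (a%:R * b%:R * g a + a%:R * b%:R * g b))) in E2; last first.
  by move=> a b *; rewrite !natrM !natrD; ring.
rewrite /W !sumqB sumqD E1 (@sumq_split _ n (fun a b => _ * g (absdiff a b))).
rewrite (@eq_sumq _ n ltab (fun a b => _ * g (absdiff a b)) (fun a b => a%:R * b%:R *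
  g (b - a)%N)); last first.
  by move=> a b _ _ ab; congr (_ * g _); rewrite /ltab /absdiff in ab *; lia.
rewrite (@eq_sumq _ n gtab (fun a b => _ * g (absdiff a b)) (fun a b => a%:R * b%:R *
  g (a - b)%N)); last first.
  by move=> a b _ _ ab; congr (_ * g _); rewrite /gtab /absdiff in ab *; lia.
rewrite (@eq_sumq _ n eqab (fun a b => _ * g (absdiff a b)) (fun a b => a%:R ^+ 2 * g
  0%N)); last first.
  by move=> a b _ _ /eqP ->; rewrite /absdiff subnn addn0 expr2.
rewrite sumq_diag [in RHS]big_split /=.
rewrite [in RHS](eq_bigr (fun d => (\sum_(1 <= l < d) (l * (d - l))%:R * g (l + (d -
  l))%N) -
    (\sum_(1 <= l < d) (((d - l) * (l + (d - l)))%:R * g l + (l * (l + (d - l)))%:R *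
      g (d - l)%N)))); last first.
  move=> d _; rewrite -sumrB !big_nat; apply: eq_bigr => l /andP[_ /ltnW ld].
  by rewrite subnKC // !natrM; ring.
rewrite sumrB; apply: (eq_by_sub (esym E2)).
rewrite !(sumqD, sumqN, sumqZ) !sumq_split.
rewrite [sumq n eqab (fun a b => _ * g b)](@eq_sumq _ n eqab _ (fun a b => a%:R ^+ 2
  * g a)); last by
  move=> a b _ _ /eqP ->; ring.
rewrite [sumq n eqab (fun a b => a%:R * _ * g b)](@eq_sumq _ n eqab _ (fun a b =>
  a%:R ^+ 2 * g a)); last by
  move=> a b _ _ /eqP ->; ring.
rewrite [sumq n eqab (fun a b => _ * b%:R * g a)](@eq_sumq _ n eqab _ (fun a b =>
  a%:R ^+ 2 * g a)); last by
  move=> a b _ _ /eqP ->; ring.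
rewrite [sumq n eqab (fun a b => b%:R ^+ 2 * g a)](@eq_sumq _ n eqab _ (fun a b =>
  a%:R ^+ 2 * g a)); last by
  move=> a b _ _ /eqP ->; ring.
ring.
Qed.
End Liouville.

(** * Divisor sums *)

Section Dilate.
Variables (R : comNzRingType) (k : nat).
Hypothesis k_gt0 : (0 < k)%N.
Implicit Types x y : fps R.

Lemma fdilateM x y : fdilate k (x * y) = fdilate k x * fdilate k y.
Proof.
apply: fpsP => n; rewrite fcoefM; under eq_bigr do rewrite !fcoef_dilate.
rewrite fcoef_dilate; case: ifPn => [/dvdnP[m ->]|nk]; last first.
  apply/esym/big1 => -[i /= lt] _; have [ki|] := boolP (k %| i)%N;
    last by rewrite mul0r.
  have [kni|] := boolP (k %| n - i)%N; last by rewrite mulr0.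
  by rewrite -(subnKC (_ : i <= n)%N) ?dvdn_add // in nk.
rewrite mulnK // fcoefM -(big_mkord xpredT (fun i => fcoef x i * fcoef y (m - i))).
rewrite -(big_mkord xpredT (fun i => (if (k %| i)%N then fcoef x (i %/ k) else 0) *
 (if (k %| m * k - i)%N then fcoef y ((m * k - i) %/ k) else 0))).
rewrite [RHS](bigID (fun i => k %| i)%N) /= [X in _ + X]big1 ?addr0; last first.
  by move=> i /negPf ->; rewrite mul0r.
apply: (big_bij (h := fun i => (i * k)%N) (h' := fun i => (i %/ k)%N)).
- exact: iota_uniq.
- exact: iota_uniq.
- move=> i; rewrite !mem_index_iota => lt _; rewrite dvdn_mull // mulnK //.
  rewrite -mulnBl dvdn_mull // mulnK //; split=> //.
  by rewrite /= !ltnS leq_mul2r; move: lt => /andP[_]; rewrite ltnS => ->; rewrite orbT.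
- move=> i; rewrite !mem_index_iota => lt ki; rewrite divnK //; split=> //.
  by rewrite /= ltnS leq_divLR // -ltnS; case/andP: lt.
Qed.

Lemma fdilateD x y : fdilate k (x + y) = fdilate k x + fdilate k y.
Proof. by apply: fpsP => n; rewrite ?(fcoefD, fcoefN, fcoef_dilate); case: ifP;
  rewrite ?addr0. Qed.
Lemma fdilateN x : fdilate k (- x) = - fdilate k x.
Proof. by apply: fpsP => n; rewrite ?(fcoefD, fcoefN, fcoef_dilate); case: ifP;
  rewrite ?oppr0. Qed.
Lemma fdilateB x y : fdilate k (x - y) = fdilate k x - fdilate k y.
Proof. by rewrite fdilateD fdilateN. Qed.
Lemma fdilate1 : fdilate k (1 : fps R) = 1.
Proof.
apply: fpsP => n; rewrite fcoef_dilate !fcoef1; case: ifPn => [/dvdnP[m ->]|kn].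
  by rewrite mulnK // muln_eq0 orbC eqn0Ngt k_gt0.
by case: n kn => // ; rewrite dvdn0.
Qed.
Lemma fdilateMn x m : fdilate k (x *+ m) = fdilate k x *+ m.
Proof. by apply: fpsP => n; rewrite !(fcoefMn, fcoef_dilate); case: ifP;
  rewrite ?mul0rn. Qed.
Lemma fdilate_nat m : fdilate k (m%:R : fps R) = m%:R.
Proof. by rewrite fdilateMn fdilate1. Qed.
Lemma fdilate_natM m x : fdilate k (m%:R * x) = m%:R * fdilate k x.
Proof. by rewrite fdilateM fdilate_nat. Qed.
Lemma fderiv_dilate x : fderiv (fdilate k x) = k%:R * fdilate k (fderiv x).
Proof.
apply: fpsP => n; rewrite mulr_natl fcoefMn fcoef_deriv !fcoef_dilate fcoef_deriv;
  case: ifPn => [/divnK e|]; last first.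
  by rewrite !mul0rn.
by rewrite -mulrnA e.
Qed.
End Dilate.

Section Divisors.
Variable V : nmodType.

Lemma sum_divisors_flip n (F : nat -> V) : (0 < n)%N ->
  \sum_(d <- divisors n) F (n %/ d)%N = \sum_(d <- divisors n) F d.
Proof.
move=> n0; apply: (big_bij (h := fun d => (n %/ d)%N) (h' := fun d => (n %/ d)%N));
  rewrite ?divisors_uniq // => d; rewrite -!dvdn_divisors // => dn _;
  by rewrite divnA // mulKn // dvdn_div.
Qed.

Lemma sum_divisors_mul n k (F : nat -> V) : (0 < n)%N -> (0 < k)%N ->
  \sum_(d <- divisors n | (k %| d)%N) F d =
  if (k %| n)%N then \sum_(d <- divisors (n %/ k)) F (d * k)%N else 0.
Proof.
move=> n0 k0; case: ifPn => kn; last first.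
  rewrite big1_seq // => d /andP[kd]; rewrite -dvdn_divisors // => /(dvdn_trans kd).
  by rewrite (negPf kn).
have m0 : (0 < n %/ k)%N by rewrite divn_gt0 // dvdn_leq.
apply: (big_bij (h := fun d => (d %/ k)%N) (h' := fun d => (d * k)%N));
  rewrite ?divisors_uniq // => d; rewrite -!dvdn_divisors //.
  by move=> dn kd; rewrite divnK // dvdn_divRL // divnK.
by move=> dn _; rewrite mulnK // dvdn_mull // -dvdn_divRL.
Qed.

End Divisors.

(** * Closed forms of the inner sums *)

Section PowerSums.
Implicit Types (h G : nat -> rat).

Lemma sum_telescope h G d : (0 < d)%N -> G 1%N = 0 ->
    (forall m, (0 < m)%N -> (m < d)%N -> G m.+1 - G m = h m) ->
  \sum_(1 <= l < d) h l = G d.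
Proof.
move=> d0 G1 hG; rewrite -[RHS]subr0 -[X in _ - X]G1 -(telescope_sumr G d0).
by rewrite !big_nat; apply: eq_bigr => l /andP[? ?]; rewrite hG.
Qed.

Lemma sum_nat_rev_sub h d : \sum_(1 <= l < d) h (d - l)%N = \sum_(1 <= l < d) h l.
Proof. by rewrite [RHS]big_nat_rev; apply: eq_bigr => l _; rewrite add1n subSS. Qed.

(* [pow_sumk m = \sum_(l < m) l ^ k] *)
Definition pow_sum1 (m : rat) := m * (m - 1) / 2.
Definition pow_sum2 (m : rat) := m * (m - 1) * (2 * m - 1) / 6.
Definition pow_sum3 (m : rat) := m ^+ 2 * (m - 1) ^+ 2 / 4.
Definition pow_sum4 (m : rat) := m * (m - 1) * (2 * m - 1) * (3 * m ^+ 2 - 3 * m - 1)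
  / 30.
Definition pow_sum5 (m : rat) := m ^+ 2 * (m - 1) ^+ 2 * (2 * m ^+ 2 - 2 * m - 1) / 12.
Definition pow_sum6 (m : rat) :=
  m * (m - 1) * (2 * m - 1) * (3 * m ^+ 4 - 6 * m ^+ 3 + 3 * m + 1) / 42.

Lemma sum_sq (d : nat) : (0 < d)%N ->
  \sum_(1 <= l < d) (d%:R ^+ 2 + l%:R ^+ 2 + (d - l)%:R ^+ 2) =
  5 / 3 * d%:R ^+ 3 - 2 * d%:R ^+ 2 + d%:R / 3 :> rat.
Proof.
(* The summand is expanded in powers of [l]: [2 d^2 - 2 d l + 2 l^2], each power being replaced by
   its sum. *)
move=> d0; rewrite (@sum_telescope _ (fun m => 2 * d%:R ^+ 2 * (m%:R - 1)
  - 2 * d%:R * pow_sum1 m%:R + 2 * pow_sum2 m%:R)) //.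
- by rewrite /pow_sum1 /pow_sum2; field.
- by rewrite /pow_sum1 /pow_sum2; field.
- by move=> m _ /ltnW md; rewrite natrB // -natr1 /pow_sum1 /pow_sum2; field.
Qed.

Lemma sum_pow4 (d : nat) : (0 < d)%N ->
  \sum_(1 <= l < d) (d%:R ^+ 4 + l%:R ^+ 4 + (d - l)%:R ^+ 4) =
  7 / 5 * d%:R ^+ 5 - 2 * d%:R ^+ 4 + 2 / 3 * d%:R ^+ 3 - d%:R / 15 :> rat.
Proof.
move=> d0; rewrite (@sum_telescope _ (fun m => 2 * d%:R ^+ 4 * (m%:R - 1)
  - 4 * d%:R ^+ 3 * pow_sum1 m%:R + 6 * d%:R ^+ 2 * pow_sum2 m%:R - 4 * d%:R *
      pow_sum3 m%:R
  + 2 * pow_sum4 m%:R)) //.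
- by rewrite /pow_sum1 /pow_sum2 /pow_sum3 /pow_sum4; field.
- by rewrite /pow_sum1 /pow_sum2 /pow_sum3 /pow_sum4; field.
- by move=> m _ /ltnW md;
    rewrite natrB // -natr1 /pow_sum1 /pow_sum2 /pow_sum3 /pow_sum4; field.
Qed.

Lemma sum_pow6 (d : nat) : (0 < d)%N ->
  \sum_(1 <= l < d) (d%:R ^+ 6 + l%:R ^+ 6 + (d - l)%:R ^+ 6) =
  9 / 7 * d%:R ^+ 7 - 2 * d%:R ^+ 6 + d%:R ^+ 5 - d%:R ^+ 3 / 3 + d%:R / 21 :> rat.
Proof.
move=> d0; rewrite (@sum_telescope _ (fun m => 2 * d%:R ^+ 6 * (m%:R - 1)
  - 6 * d%:R ^+ 5 * pow_sum1 m%:R + 15 * d%:R ^+ 4 * pow_sum2 m%:R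
  - 20 * d%:R ^+ 3 * pow_sum3 m%:R + 15 * d%:R ^+ 2 * pow_sum4 m%:R
  - 6 * d%:R * pow_sum5 m%:R + 2 * pow_sum6 m%:R)) //.
- by rewrite /pow_sum1 /pow_sum2 /pow_sum3 /pow_sum4 /pow_sum5 /pow_sum6; field.
- by rewrite /pow_sum1 /pow_sum2 /pow_sum3 /pow_sum4 /pow_sum5 /pow_sum6; field.
- by move=> m _ /ltnW md;
    rewrite natrB // -natr1 /pow_sum1 /pow_sum2 /pow_sum3 /pow_sum4 /pow_sum5
    /pow_sum6; field.
Qed.

Lemma sum_conv4 (d : nat) : (0 < d)%N ->
  \sum_(1 <= l < d) ((l * (d - l))%:R * d%:R ^+ 4 -
     (d * (d - l))%:R * l%:R ^+ 4 - (d * l)%:R * (d - l)%:R ^+ 4) =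
  (d%:R ^+ 7 - d%:R ^+ 3) / 10 :> rat.
Proof.
(* Since [d^3 - l^3 - (d - l)^3 = 3 d l (d - l)], the summand is [3 d^2 l^2 (d - l)^2]. *)
move=> d0; rewrite (@sum_telescope _ (fun m => 3 * d%:R ^+ 4 * pow_sum2 m%:R
  - 6 * d%:R ^+ 3 * pow_sum3 m%:R + 3 * d%:R ^+ 2 * pow_sum4 m%:R)) //.
- by rewrite /pow_sum2 /pow_sum3 /pow_sum4; field.
- by rewrite /pow_sum2 /pow_sum3 /pow_sum4; field.
- by move=> m _ /ltnW md;
    rewrite !natrM natrB // -natr1 /pow_sum2 /pow_sum3 /pow_sum4; field.
Qed.

End PowerSums.

(** * Products of divisor sums *)

Definition sigma (k : nat) : fps rat := lambert (fun d => d%:R ^+ k).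

Definition mul3 (d : nat) : rat := (3 %| d)%N%:R.
(** The nontrivial Dirichlet character modulo 3. *)
Definition chi3 (d : nat) : rat :=
  if (d %% 3 == 1)%N then 1 else if (d %% 3 == 2)%N then -1 else 0.

Lemma sigma_fcoef0 k : fcoef (sigma k) 0 = 0. Proof. by []. Qed.
Lemma fderiv_fcoef0 (R : comNzRingType) (x : fps R) : fcoef (fderiv x) 0 = 0.
Proof. by []. Qed.
Lemma sigma_fcoef k n : (0 < n)%N ->
  fcoef (sigma k) n = \sum_(d <- divisors n) d%:R ^+ k.
Proof. exact: fcoef_lambert. Qed.

Lemma eq_big_divisors (V : nmodType) n (F G : nat -> V) : (0 < n)%N ->
  (forall d, (0 < d)%N -> (d %| n)%N -> F d = G d) ->
  \sum_(d <- divisors n) F d = \sum_(d <- divisors n) G d.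
Proof.
move=> n0 e; apply: eq_big_seq => d; rewrite -dvdn_divisors // => dn.
exact: e (dvdn_gt0 n0 dn) dn.
Qed.

Lemma sumq_sigma i j n :
  sumq n allab (fun a b => a%:R ^+ i * b%:R ^+ j : rat) = fcoef (sigma i * sigma j) n.
Proof. by rewrite /sigma lambertM. Qed.

Lemma absdiff_exp k (a b : nat) : ~~ odd k ->
  (absdiff a b)%:R ^+ k = (a%:R - b%:R) ^+ k :> rat.
Proof.
move=> ek; have [ab|/ltnW ab] := leqP b a.
  by rewrite /absdiff (eqP ab) addn0 natrB.
rewrite /absdiff (eqP ab) add0n natrB // -[a%:R - _]opprB exprNn.
by rewrite -signr_odd (negPf ek) mul1r.
Qed.

Lemma natr_divn_sub1 (R : comNzRingType) (d n : nat) : (0 < n)%N -> (d %| n)%N ->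
  (n %/ d - 1)%:R * d%:R = n%:R - d%:R :> R.
Proof.
move=> n0 dn; have d0 := dvdn_gt0 n0 dn.
by rewrite -natrM mulnBl mul1n divnK // natrB // dvdn_leq.
Qed.

(** The first identity for [f x = x^2], as [(a + b)^2 - (a - b)^2 = 4 a b]. The derivative comes
    from the weights: [(n / d - 1) d = n - d]. *)
Lemma sigma11 : 12 * (sigma 1 * sigma 1) = 5 * sigma 3 + sigma 1 - 6 * fderiv (sigma 1).
Proof.
apply: fpsP => n; have [->|n0] := posnP n.
  by rewrite !(fcoefD, fcoefN, fcoef_natM, fcoefM0, sigma_fcoef0, fderiv_fcoef0); ring.
have := liouville1 n (fun x => x%:R ^+ 2 : rat).
rewrite (@eq_sumq _ n _ _ (fun a b => 4 * (a%:R ^+ 1 * b%:R ^+ 1))); last first.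
  by move=> a b _ _ _; rewrite absdiff_exp // natrD; ring.
rewrite sumqZ sumq_sigma.
rewrite (@eq_big_divisors _ n _ (fun d => (5 * d%:R ^+ 3 + d%:R ^+ 1 - 6 * (n%:R *
  d%:R ^+ 1)) / 3)) //; last first.
  move=> d d0 dn; rewrite sum_sq // expr0n addr0.
  rewrite (_ : _ * (2 * _) = 2 * ((n %/ d - 1)%:R * d%:R) * d%:R); last by ring.
  by rewrite natr_divn_sub1 //; field.
rewrite -mulr_suml sumrB big_split /= -!mulr_sumr -!sigma_fcoef // => H.
rewrite !(fcoefD, fcoefN, fcoef_natM) fcoef_deriv -mulr_natl; lra.
Qed.

Lemma sigma13 : 240 * (sigma 1 * sigma 3) =
  21 * sigma 5 + 10 * sigma 3 - 30 * fderiv (sigma 3) - sigma 1.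
Proof.
apply: fpsP => n; have [->|n0] := posnP n.
  by rewrite !(fcoefD, fcoefN, fcoef_natM, fcoefM0, sigma_fcoef0, fderiv_fcoef0); ring.
have := liouville1 n (fun x => x%:R ^+ 4 : rat).
rewrite (@eq_sumq _ n _ _ (fun a b => 8 * (a%:R ^+ 1 * b%:R ^+ 3 + a%:R ^+ 3 * b%:R
  ^+ 1))); last first.
  by move=> a b _ _ _; rewrite absdiff_exp // natrD; ring.
rewrite sumqZ sumqD !sumq_sigma [sigma 3 * _]mulrC.
rewrite (@eq_big_divisors _ n _ (fun d => (21 * d%:R ^+ 5 + 10 * d%:R ^+ 3 - 30 *
  (n%:R * d%:R ^+ 3) - d%:R ^+ 1) / 15)) //; last first.
  move=> d d0 dn; rewrite sum_pow4 // expr0n addr0.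
  rewrite (_ : _ * (2 * _) = 2 * ((n %/ d - 1)%:R * d%:R) * d%:R ^+ 3); last by ring.
  by rewrite natr_divn_sub1 //; field.
rewrite -mulr_suml 2!sumrB big_split /= -!mulr_sumr -!sigma_fcoef // => H.
rewrite !(fcoefD, fcoefN, fcoef_natM) fcoef_deriv -mulr_natl; lra.
Qed.

(** Equivalent to [E4^2 = E8]. It comes from the second identity for [g x = x^4], and separates the
    two products that the first identity mixes for [f x = x^6]. *)
Lemma sigma33 : 120 * (sigma 3 * sigma 3) = sigma 7 - sigma 3.
Proof.
apply: fpsP => n; have [->|n0] := posnP n.
  by rewrite !(fcoefD, fcoefN, fcoef_natM, fcoefM0, sigma_fcoef0, fderiv_fcoef0); ring.
have := liouville2 n (fun x => x%:R ^+ 4 : rat).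
rewrite (@eq_sumq _ n _ _ (fun a b => 12 * (a%:R ^+ 3 * b%:R ^+ 3))); last first.
  by move=> a b _ _ _; rewrite absdiff_exp // natrD natrM; ring.
rewrite sumqZ !sumq_sigma.
rewrite (@eq_big_divisors _ n _ (fun d => (d%:R ^+ 7 - d%:R ^+ 3) / 10)) //; last first.
  by move=> d d0 dn; rewrite sum_conv4 // expr0n !mulr0 addr0.
rewrite -mulr_suml !sumrB -!sigma_fcoef // => H.
rewrite !(fcoefD, fcoefN, fcoef_natM); lra.
Qed.

Lemma sigma15 : 504 * (sigma 1 * sigma 5) =
  20 * sigma 7 + 21 * sigma 5 + sigma 1 - 42 * fderiv (sigma 5).
Proof.
apply: fpsP => n; have [->|n0] := posnP n.
  by rewrite !(fcoefD, fcoefN, fcoef_natM, fcoefM0, sigma_fcoef0, fderiv_fcoef0); ring.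
have := liouville1 n (fun x => x%:R ^+ 6 : rat).
rewrite (@eq_sumq _ n _ _ (fun a b => 12 * (a%:R ^+ 1 * b%:R ^+ 5 + a%:R ^+ 5 * b%:R
  ^+ 1)
   + 40 * (a%:R ^+ 3 * b%:R ^+ 3))); last first.
  by move=> a b _ _ _; rewrite absdiff_exp // natrD; ring.
rewrite sumqD !sumqZ sumqD !sumq_sigma [sigma 5 * _]mulrC.
rewrite (@eq_big_divisors _ n _ (fun d => (27 * d%:R ^+ 7 + 21 * d%:R ^+ 5 - 42 *
  (n%:R * d%:R ^+ 5) - 7 * d%:R ^+ 3 + d%:R ^+ 1) / 21)) //; last first.
  move=> d d0 dn; rewrite sum_pow6 // expr0n addr0.
  rewrite (_ : _ * (2 * _) = 2 * ((n %/ d - 1)%:R * d%:R) * d%:R ^+ 5); last by ring.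
  by rewrite natr_divn_sub1 //; field.
rewrite -mulr_suml big_split 2!sumrB big_split /= -!mulr_sumr -!sigma_fcoef // => H.
have := congr1 (fun x => fcoef x n) sigma33.
rewrite !(fcoefD, fcoefN, fcoef_natM) fcoef_deriv -mulr_natl; lra.
Qed.

Lemma mod3_cases d : exists k, [\/ d = 3 * k, d = (3 * k).+1 | d = (3 * k).+2]%N.
Proof.
exists (d %/ 3)%N; have := divn_eq d 3; have := ltn_pmod d (isT : 0 < 3)%N.
case: (d %% 3)%N => [|[|[|]]] // _ e; [constructor 1|constructor 2|constructor 3]; lia.
Qed.

Lemma mul3_0 k : mul3 (3 * k) = 1. Proof. by rewrite /mul3 dvdn_mulr. Qed.
Lemma mul3_1 k : mul3 (3 * k).+1 = 0.
Proof. by rewrite /mul3 (_ : (3 %| _) = false)%N //; lia. Qed.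
Lemma mul3_2 k : mul3 (3 * k).+2 = 0.
Proof. by rewrite /mul3 (_ : (3 %| _) = false)%N //; lia. Qed.
Lemma chi3_0 k : chi3 (3 * k) = 0.
Proof. by rewrite /chi3 modnMr. Qed.
Lemma chi3_1 k : chi3 (3 * k).+1 = 1.
Proof. by rewrite /chi3 (_ : (_ %% 3 = 1)%N) //; lia. Qed.
Lemma chi3_2 k : chi3 (3 * k).+2 = -1.
Proof. by rewrite /chi3 (_ : (_ %% 3 = 2)%N) //; lia. Qed.
Definition res3E := (mul3_0, mul3_1, mul3_2, chi3_0, chi3_1, chi3_2).

Lemma mul3S_cases d : [/\ mul3 d = 1, chi3 d = 0, mul3 d.+1 = 0 & chi3 d.+1 = 1]
  \/ [/\ mul3 d = 0, chi3 d = 1, mul3 d.+1 = 0 & chi3 d.+1 = -1]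
  \/ [/\ mul3 d = 0, chi3 d = -1, mul3 d.+1 = 1 & chi3 d.+1 = 0].
Proof.
have [k [->|->|->]] := mod3_cases d; rewrite ?res3E; [by left|by right; left|right;
  right].
by rewrite (_ : (3 * k).+3 = 3 * k.+1)%N ?res3E //; lia.
Qed.

Lemma chi3_modn d :
  chi3 d = ((d %% 3)%N == 1%N)%:R - ((d %% 3)%N == 2%N)%:R.
Proof.
rewrite /chi3; case: (d %% 3)%N (ltn_pmod d (isT : 0 < 3)%N) => [|[|[|]]] //.
Qed.

Lemma mul3_modn d : mul3 d = ((d %% 3)%N == 0%N)%:R.
Proof. by []. Qed.

Lemma mul3D_modn a b : mul3 (a + b) = ((a %% 3 + b %% 3) %% 3 == 0)%N%:R.
Proof. by rewrite mul3_modn modnDm. Qed.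

Lemma mul3_absdiff_modn a b : mul3 (absdiff a b) = (a %% 3 == b %% 3)%N%:R.
Proof. by rewrite /mul3 /absdiff; congr (_%:R); lia. Qed.

(** Turns the first identity, taken at the indicator of the multiples of 3, into a formula for the
    square of the Lambert series of [chi3]. *)
Lemma mul3D_sub (a b : nat) :
  mul3 (a + b) - mul3 (absdiff a b) = - (chi3 a * chi3 b).
Proof.
rewrite mul3D_modn mul3_absdiff_modn !chi3_modn.
have := ltn_pmod a (isT : 0 < 3)%N; have := ltn_pmod b (isT : 0 < 3)%N.
by move: (a %% 3)%N (b %% 3)%N => [|[|[|]]] // [|[|[|]]].
Qed.

(** The counterpart for the second identity, taken at the indicator of the integers prime to 3. *)
Lemma mul3D_add (a b : nat) (g := fun d => 1 - mul3 d) :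
  g (a + b)%N + g (absdiff a b) - 2 * g a - 2 * g b = -3 * (g a * g b).
Proof.
rewrite /g mul3D_modn mul3_absdiff_modn !mul3_modn.
have := ltn_pmod a (isT : 0 < 3)%N; have := ltn_pmod b (isT : 0 < 3)%N.
by move: (a %% 3)%N (b %% 3)%N => [|[|[|]]] // [|[|[|]]].
Qed.

(** The count is the integer part of [(d - 1) / 3]; its fluctuation has period 3, hence is a
    combination of [1], [mul3] and [chi3]. *)
Lemma sum_mul3 d : (0 < d)%N ->
  \sum_(1 <= l < d) mul3 l = d%:R / 3 - 1 / 2 - mul3 d / 2 + chi3 d / 6.
Proof.
move=> d0; apply: (sum_telescope (G := fun d => d%:R / 3 - 1 / 2 - mul3 d / 2 + chi3
  d / 6)) => //.
move=> m _ _; rewrite -natr1.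
by have [[-> -> -> ->]|[[-> -> -> ->]|[-> -> -> ->]]] := mul3S_cases m; field.
Qed.

Lemma sum_conv_mul3 d : (0 < d)%N ->
  \sum_(1 <= l < d) (d - l)%:R * (1 - mul3 l) = (d%:R ^+ 2 - (1 - mul3 d)) / 3.
Proof.
elim: d => // -[_ _|d IH _]; first by rewrite big_geq // /mul3 /=; field.
rewrite (eq_big_nat _ _ (F2 := fun l => (d.+1 - l)%:R * (1 - mul3 l) + (1 - mul3
  l))); last first.
  by move=> l /andP[_ ld]; rewrite subSn // -natr1; ring.
rewrite big_split /= big_nat_recr //= subnn mul0r addr0 IH //.
rewrite sumrB sum_mul3 // sumr_const_nat subSS subn0 -mulr_natl mulr1.
rewrite -!natr1.
by have [[-> _ -> ->]|[[-> _ -> ->]|[-> _ -> ->]]] := mul3S_cases d.+1; field.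
Qed.

Definition twist : fps rat := lambert chi3.

Lemma sum_divisors_mul3 n (F : nat -> rat) : (0 < n)%N ->
  \sum_(d <- divisors n) F d * mul3 d =
  if (3 %| n)%N then \sum_(d <- divisors (n %/ 3)) F (d * 3)%N else 0.
Proof.
move=> n0; rewrite -(sum_divisors_mul _ n0) // [RHS]big_mkcond.
by apply: eq_bigr => d _; rewrite /mul3; case: ifP; rewrite ?mulr1 ?mulr0.
Qed.

Lemma sigma_dilate3 k n : (0 < n)%N ->
  \sum_(d <- divisors n) d%:R ^+ k * mul3 d =
  3 ^+ k * fcoef (fdilate 3 (sigma k)) n.
Proof.
move=> n0; rewrite (sum_divisors_mul3 _ n0) fcoef_dilate.
case: ifPn => n3; last by rewrite mulr0.
have m0 : (0 < n %/ 3)%N by rewrite divn_gt0 // dvdn_leq.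
rewrite sigma_fcoef // mulr_sumr.
by apply: eq_bigr => d _; rewrite natrM exprMn mulrC.
Qed.

Lemma sum_codivisor_mul3 n : (0 < n)%N ->
  \sum_(d <- divisors n) (n %/ d)%:R * mul3 d = fcoef (fdilate 3 (sigma 1)) n.
Proof.
move=> n0; rewrite (sum_divisors_mul3 (fun d => (n %/ d)%:R) n0) fcoef_dilate.
case: ifPn => // n3; have m0 : (0 < n %/ 3)%N by rewrite divn_gt0 // dvdn_leq.
rewrite sigma_fcoef // -[RHS](sum_divisors_flip (fun d => d%:R ^+ 1) m0).
by apply: eq_bigr => d _; rewrite expr1 (mulnC d) divnMA.
Qed.

(** The linear term completes the square: it says that [(1 + 6 twist)^2] is 1 plus 12 times
    [sigma 1 - 3 fdilate 3 (sigma 1)]. *)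
Lemma twist_sqr : 3 * (twist * twist) = sigma 1 - 3 * fdilate 3 (sigma 1) - twist.
Proof.
apply: fpsP => n; have [->|n0] := posnP n.
  by rewrite !(fcoefD, fcoefN, fcoef_natM, fcoefM0, fcoef_lambert0, fcoef_dilate,
    dvdn0, div0n, sigma_fcoef0); ring.
have := liouville1 n mul3.
rewrite (@eq_sumq _ n _ _ (fun a b => - (chi3 a * chi3 b))); last first.
  by move=> a b _ _ _; rewrite mul3D_sub.
rewrite sumqN -lambertM -/twist.
rewrite (@eq_big_divisors _ n _ (fun d => d%:R ^+ 1 * mul3 d + (2 * d%:R ^+ 1 + chi3
  d) / 3
   - 2 * ((n %/ d)%:R * mul3 d) - (n %/ d)%:R)) //; last first.
  (* The boundary value is [mul3 0 = 1], not 0; it contributes the sum of the codivisors [n / d],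
     which is again [sigma 1]. *)
  move=> d d0 dn; rewrite !big_split /= (sum_nat_rev_sub mul3) sum_mul3 //.
  rewrite sumr_const_nat -[mul3 d *+ _]mulr_natl (_ : mul3 0 = 1) //.
  have nd : (0 < n %/ d)%N by rewrite divn_gt0 // dvdn_leq.
  by rewrite (natrB _ d0) (natrB _ nd); field.
rewrite 2!sumrB big_split /= -mulr_suml big_split /= -!mulr_sumr sigma_dilate3 //.
rewrite sum_codivisor_mul3 // (sum_divisors_flip (fun d => d%:R)) //.
rewrite -[\sum_(d <- _) chi3 d]fcoef_lambert // -/twist.
have -> : \sum_(d <- divisors n) d%:R = fcoef (sigma 1) n :> rat by rewrite sigma_fcoef.
move=> H; rewrite !(fcoefD, fcoefN, fcoef_natM); lra.
Qed.

(** The coefficients of [T] are sums of divisors prime to 3, so the second identity at the indicator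
    of such integers has a multiple of [T^2] on its left-hand side. *)
Lemma sigma_prime_to3_sqr (T := sigma 1 - 3 * fdilate 3 (sigma 1)) :
  6 * (T * T) = sigma 3 + 9 * fdilate 3 (sigma 3) - T.
Proof.
have eT : T = lambert (fun d => d%:R * (1 - mul3 d)).
  apply: fpsP => n; have [->|n0] := posnP n.
    by rewrite !(fcoefD, fcoefN, fcoef_natM, fcoef_dilate, fcoef_lambert0, dvdn0,
      div0n, sigma_fcoef0); ring.
  rewrite !(fcoefD, fcoefN, fcoef_natM) fcoef_lambert //.
  under [RHS]eq_bigr => d _ do rewrite mulrBr mulr1 -[d%:R]expr1.
  by rewrite sumrB sigma_dilate3 // sigma_fcoef.
apply: fpsP => n; have [->|n0] := posnP n.
  rewrite eT.
  by rewrite !(fcoefD, fcoefN, fcoef_natM, fcoefM0, fcoef_lambert0, fcoef_dilate,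
    dvdn0, div0n, sigma_fcoef0); ring.
have := liouville2 n (fun d => 1 - mul3 d).
rewrite (@eq_sumq _ n _ _ (fun a b => -3 * ((a%:R * (1 - mul3 a)) * (b%:R * (1 - mul3
  b))))); last first.
  by move=> a b _ _ _; rewrite mul3D_add natrM; ring.
rewrite sumqZ -lambertM -eT.
rewrite (@eq_big_divisors _ n _ (fun d => ((d%:R ^+ 1 - d%:R ^+ 1 * mul3 d) / 2 -
   (d%:R ^+ 3 * mul3 d) / 6 - d%:R ^+ 3 / 2))) //; last first.
  move=> d d0 dn; rewrite (_ : 1 - mul3 0 = 0) // !mulr0 addr0 !sumrB.
  have -> : \sum_(1 <= l < d) (d * l)%:R * (1 - mul3 (d - l)) =
            \sum_(1 <= l < d) (d * (d - l))%:R * (1 - mul3 l) :> rat.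
    rewrite -(sum_nat_rev_sub (fun l => (d * (d - l))%:R * (1 - mul3 l))).
    by rewrite !big_nat; apply: eq_bigr => l /andP[_ /ltnW ld]; rewrite subKn.
  have -> : \sum_(1 <= l < d) (d * (d - l))%:R * (1 - mul3 l) =
            d%:R * ((d%:R ^+ 2 - (1 - mul3 d)) / 3) :> rat.
    rewrite -sum_conv_mul3 // mulr_sumr; apply: eq_bigr => l _.
    by rewrite natrM mulrA.
  rewrite (@sum_telescope _ (fun m => (1 - mul3 d) * (d%:R * pow_sum1 m%:R - pow_sum2
    m%:R))) //.
  - by rewrite /pow_sum1 /pow_sum2; field.
  - by rewrite /pow_sum1 /pow_sum2; field.
  - by move=> m _ /ltnW md; rewrite natrM natrB // -natr1 /pow_sum1 /pow_sum2; field.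
rewrite !sumrB -!mulr_suml sumrB !sigma_dilate3 // -!sigma_fcoef // => H.
rewrite !(fcoefD, fcoefN, fcoef_natM) in H *; lra.
Qed.

(** * Eisenstein series and the hexagonal theta series *)

(** The four series are locked so that [ring] treats them as atoms. *)
HB.lock Definition E2 : fps rat := 1 - 24 * sigma 1.
HB.lock Definition E4 : fps rat := 1 + 240 * sigma 3.
HB.lock Definition E6 : fps rat := 1 - 504 * sigma 5.
HB.lock Definition theta : fps rat := 1 + 6 * twist.

Lemma fps_natI (k : nat) (x y : fps rat) : (0 < k)%N -> k%:R * x = k%:R * y -> x = y.
Proof.
move=> k0 e; apply: fpsP => n; have := congr1 (fun z => fcoef z n) e.
rewrite /= !fcoef_natM; apply: mulfI.
by rewrite pnatr_eq0 -lt0n.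
Qed.

Lemma fderiv1 (R : comNzRingType) : fderiv (1 : fps R) = 0.
Proof. exact: (fderiv_nat _ 1). Qed.

Lemma deriv_E2 : 12 * fderiv E2 = E2 * E2 - E4.
Proof.
rewrite E2.unlock E4.unlock fderivB fderiv1 fderiv_natM.
apply: (eq_by_sub (esym (congr1 (fun x => 48 * x) sigma11))); ring.
Qed.

Lemma deriv_E4 : 3 * fderiv E4 = E2 * E4 - E6.
Proof.
rewrite E2.unlock E4.unlock E6.unlock fderivD fderiv1 fderiv_natM.
apply: (eq_by_sub (congr1 (fun x => 24 * x) sigma13)); ring.
Qed.

Lemma deriv_E6 : 2 * fderiv E6 = E2 * E6 - E4 * E4.
Proof.
rewrite E2.unlock E4.unlock E6.unlock fderivB fderiv1 fderiv_natM.
apply: (eq_by_sub (congr1 (fun x => -24 * x) sigma15)).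
apply: (eq_by_sub (congr1 (fun x => 480 * x) sigma33)); ring.
Qed.

Lemma theta_sqr : 2 * (theta * theta) = 3 * fdilate 3 E2 - E2.
Proof.
rewrite theta.unlock E2.unlock fdilateD fdilateN // fdilate1 // fdilate_natM //.
apply: (eq_by_sub (congr1 (fun x => 24 * x) twist_sqr)); ring.
Qed.

Lemma theta_sqr_sqr : 10 * (theta * theta * (theta * theta)) = 9 * fdilate 3 E4 + E4.
Proof.
apply: (@fps_natI 4) => //.
apply: (eq_by_sub (congr1 (fun x => 10 * (x * x)) theta_sqr)).
apply: (eq_by_sub (congr1 (fun x => 960 * x) sigma_prime_to3_sqr)).
rewrite E2.unlock E4.unlock fdilateB fdilateD fdilate1 // 2?fdilate_natM //; ring.
Qed.

(** Ramanujan's equation for [E2] is used at [q] and at [q^3]. The formulas for [theta^2] and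
    [theta^4] then eliminate both series in [q^3], and the equation has coefficients of level 1. *)
Lemma deriv_theta_sqr (t := theta * theta) :
  12 * fderiv t = 2 * (t * E2) - 3 * (t * t) + E4.
Proof.
apply: (@fps_natI 2) => //.
have := congr1 (fun x => 12 * fderiv x) theta_sqr.
rewrite fderivB !fderiv_natM fderiv_dilate // -/t => H.
transitivity (12 * (2 * fderiv t)); first by ring.
rewrite H.
transitivity (9 * (12 * fdilate 3 (fderiv E2)) - 12 * fderiv E2); first by ring.
have -> : 12 * fdilate 3 (fderiv E2) = fdilate 3 (12 * fderiv E2).
  by rewrite fdilate_natM.
rewrite deriv_E2 fdilateB // fdilateM //.
have t2 := theta_sqr; have t4 := theta_sqr_sqr; rewrite -/t in t2 t4.
transitivity ((3 * fdilate 3 E2 - E2) * ((3 * fdilate 3 E2 - E2) + 2 * E2) - (9 *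
  fdilate 3 E4 + E4) + 2 * E4).
  by ring.
by rewrite -t2 -t4; ring.
Qed.

(** When the lower coefficients vanish, degree [n] of the equation reads [(k n - y_0) x_n = 0]. *)
Lemma fps_ode_eq0 (x y : fps rat) (k : nat) :
    k%:R * fderiv x = y * x -> fcoef x 0 = 0 ->
    (forall n, (0 < n)%N -> k%:R * n%:R != fcoef y 0) ->
  x = 0.
Proof.
move=> ode x0 yn; apply: fpsP => n; rewrite fcoef0; elim/ltn_ind: n => n IH.
have [->//|n0] := posnP n.
have := congr1 (fun z => fcoef z n) ode.
rewrite /= fcoef_natM fcoef_deriv fcoefM big_ord_recl subn0 big1 ?addr0; last first.
  by move=> i _; rewrite IH ?mulr0 //= /bump; lia.
move/eqP; rewrite -[_ *+ n]mulr_natl mulrA -subr_eq0 -mulrBl mulf_eq0 subr_eq0 (negPf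
  (yn n n0)).
by move=> /eqP.
Qed.

Lemma E2_0 : fcoef E2 0 = 1.
Proof. by rewrite E2.unlock fcoefB fcoef_natM sigma_fcoef0 mulr0 subr0. Qed.
Lemma E4_0 : fcoef E4 0 = 1.
Proof. by rewrite E4.unlock fcoefD fcoef_natM sigma_fcoef0 mulr0 addr0. Qed.
Lemma E6_0 : fcoef E6 0 = 1.
Proof. by rewrite E6.unlock fcoefB fcoef_natM sigma_fcoef0 mulr0 subr0. Qed.
Lemma theta_0 : fcoef theta 0 = 1.
Proof. by rewrite theta.unlock fcoefD fcoef_natM fcoef_lambert0 mulr0 addr0. Qed.

Lemma E4_fcoef n : (0 < n)%N -> fcoef E4 n = 240 * \sum_(d <- divisors n) d%:R ^+ 3.
Proof.
by move=> n0; rewrite E4.unlock fcoefD fcoef1 eqn0Ngt n0 add0r fcoef_natM sigma_fcoef.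
Qed.
Lemma E6_fcoef n : (0 < n)%N -> fcoef E6 n = - (504 * \sum_(d <- divisors n) d%:R ^+ 5).
Proof.
by move=> n0; rewrite E6.unlock fcoefB fcoef1 eqn0Ngt n0 sub0r fcoef_natM sigma_fcoef.
Qed.
Lemma theta_fcoef n : (0 < n)%N -> fcoef theta n = 6 * \sum_(d <- divisors n) chi3 d.
Proof.
by move=> n0;
  rewrite theta.unlock fcoefD fcoef1 eqn0Ngt n0 add0r fcoef_natM fcoef_lambert.
Qed.

(* [- theta ^ 2 / 4] is the abscissa of a point of order 3 on
   [y ^ 2 = 4 x ^ 3 - E4 x / 12 + E6 / 216]; this is the 3-division polynomial. *)
Lemma theta_quartic (t := theta * theta) :
  27 * (t * t * (t * t)) - 18 * (t * t * E4) - 8 * (t * E6) - E4 * E4 = 0.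
Proof.
set Q := (X in X = 0).
(* The equation is [3 D Q = (2 E2 - 3 t) Q]; the factor has constant term [-1], which is not of the
   form [3 n]. *)
apply: (@fps_ode_eq0 Q (2 * E2 - 3 * t) 3).
- apply: (@fps_natI 12) => //.
  have dt := deriv_theta_sqr; rewrite -/t in dt.
  transitivity (3 * (108 * (t * t * t) - 36 * (t * E4) - 8 * E6) * (12 * fderiv t)
    - 12 * (18 * (t * t) + 2 * E4) * (3 * fderiv E4) - 144 * t * (2 * fderiv E6)).
    by rewrite /Q !(fderivB, fderiv_natM, fderivM); ring.
  by rewrite dt deriv_E4 deriv_E6 /Q; ring.
- by rewrite /Q /t !(E4_0, E6_0, theta_0, fcoefB, fcoef_natM, fcoefM0); ring.
- move=> n n0; rewrite /t !(E2_0, theta_0, fcoefB, fcoef_natM, fcoefM0).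
  apply/eqP; have : (1 : rat) <= n%:R by rewrite ler1n.
  lra.
Qed.

(** Since [D E4 = (E2 E4 - E6) / 3], this is [x |-> 12 E4^(5/4) D (E4^(-1/4) x)] without fractional
    powers. *)
Definition opA (x : fps rat) := 12 * E4 * fderiv x - (E2 * E4 - E6) * x.

(* Up to a factor, the hypergeometric operator of [2F1(-1/12, 1/4; 2/3; z)],
   [z = 1728 / j], conjugated by [E4 ^ (1/4)]. *)
Definition opL (x : fps rat) :=
  opA (opA x) - (6 * E2 * E4 - 2 * E6) * opA x + 3 * (E4 * E4 * E4 - E6 * E6) * x.

Lemma fps_unitI (a x : fps rat) : fcoef a 0 = 1 -> a * x = 0 -> x = 0.
Proof.
move=> a0 e; apply: fpsP => n; elim/ltn_ind: n => n IH.
have := congr1 (fun z => fcoef z n) e.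
rewrite /= fcoefM big_ord_recl subn0 big1 ?addr0 ?a0 ?mul1r //.
by move=> i _; rewrite IH ?fcoef0 ?mulr0 //= /bump; have := ltn_ord i; lia.
Qed.

(** [2 theta (opA theta)] is a polynomial [R] in [t], [E4], [E6]. Differentiating it once more,
    [48 theta^3 (opL theta)] turns out to be [12 E4^2] times the division polynomial; [theta^3] can
    be cancelled because its constant term is 1. *)
Lemma opL_theta : opL theta = 0.
Proof.
pose t := theta * theta; pose Z := opA theta.
have dt : 12 * fderiv t = 2 * (t * E2) - 3 * (t * t) + E4 := deriv_theta_sqr.
have dt' : 12 * fderiv t = 24 * (theta * fderiv theta) by rewrite /t fderivM; ring.
pose R := E4 * E4 - 3 * (t * t * E4) + 2 * (E6 * t).
have eR : 2 * (theta * Z) = R.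
  transitivity (E4 * (24 * (theta * fderiv theta)) - 2 * (E2 * E4 - E6) * t).
    by rewrite /Z /opA /t; ring.
  by rewrite -dt' dt /R; ring.
have dR : 12 * fderiv R = 8 * E4 * (3 * fderiv E4)
   - 3 * (2 * t * (12 * fderiv t) * E4 + 4 * (t * t) * (3 * fderiv E4))
   + 2 * (6 * (2 * fderiv E6) * t + E6 * (12 * fderiv t)).
  by rewrite /R !(fderivB, fderivD, fderiv_natM, fderivM); ring.
have dRZ : fderiv R = 2 * fderiv theta * Z + 2 * theta * fderiv Z.
  by rewrite -eR fderiv_natM fderivM; ring.
apply: (@fps_unitI (theta * theta * theta)).
  by rewrite !fcoefM0 theta_0 !mul1r.
apply: (@fps_natI 48) => //; rewrite mulr0.
transitivity (24 * t * (E4 * (12 * fderiv R) - (E2 * E4 - E6) * R - (6 * E2 * E4 - 2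
  * E6) * R
   + 6 * (E4 * E4 * E4 - E6 * E6) * t) - 12 * E4 * (12 * fderiv t) * R).
  by rewrite dt' dRZ -eR /opL -/Z [opA Z]/opA /t; ring.
rewrite dR dt deriv_E4 deriv_E6.
transitivity (12 * (E4 * E4) * (27 * (t * t * (t * t)) - 18 * (t * t * E4) - 8 * (t *
  E6) - E4 * E4)).
  by rewrite /R; ring.
by rewrite theta_quartic mulr0.
Qed.

(** * Congruences modulo [p] *)

Section Localization.
Variable p : nat.
Hypothesis p_prime : prime p.

(** The ring of [p]-integral rationals, with an arbitrary denominator prime to [p] as witness:
    closure under the operations needs no reduction of fractions. Reduced fractions enter only
    through [pint_denq] and [pmul_numq]. *)
Definition pint (r : rat) : Prop :=
  exists d : nat, ~~ (p %| d)%N /\ exists z : int, r * d%:R = z%:~R.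

Definition pmul (r : rat) : Prop := exists2 s, pint s & r = p%:R * s.

Lemma pint_int (z : int) : pint z%:~R.
Proof.
exists 1%N; split; first by rewrite dvdn1; case: p p_prime => [|[]].
by exists z; rewrite mulr1.
Qed.

Lemma pint_nat (m : nat) : pint m%:R.
Proof. exact: (pint_int m). Qed.

Lemma pint0 : pint 0. Proof. exact: (pint_int 0). Qed.
Lemma pint1 : pint 1. Proof. exact: (pint_int 1). Qed.

Lemma pint_dvdnM (d e : nat) : ~~ (p %| d)%N -> ~~ (p %| e)%N -> ~~ (p %| d * e)%N.
Proof. by rewrite Euclid_dvdM // negb_or => -> ->. Qed.

Lemma pintN r : pint r -> pint (- r).
Proof.
move=> [d [pd [z e]]]; exists d; split=> //; exists (- z).
by rewrite mulNr e rmorphN.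
Qed.

Lemma pintM r s : pint r -> pint s -> pint (r * s).
Proof.
move=> [d [pd [z e]]] [d' [pd' [z' e']]]; exists (d * d')%N; split.
  exact: pint_dvdnM.
by exists (z * z'); rewrite intrM -e -e' natrM; ring.
Qed.

Lemma pintD r s : pint r -> pint s -> pint (r + s).
Proof.
move=> [d [pd [z e]]] [d' [pd' [z' e']]]; exists (d * d')%N; split.
  exact: pint_dvdnM.
exists (z * d'%:Z + z' * d%:Z); rewrite intrD !intrM -e -e' natrM.
by rewrite -!pmulrn; ring.
Qed.

Lemma pintB r s : pint r -> pint s -> pint (r - s).
Proof. by move=> hr hs; apply: pintD hr (pintN hs). Qed.

Lemma pint_sum I (r : seq I) (P : pred I) (F : I -> rat) :
  (forall i, P i -> pint (F i)) -> pint (\sum_(i <- r | P i) F i).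
Proof. by move=> h; apply: big_ind => //; [exact: pint0|exact: pintD]. Qed.

Lemma pint_invn (d : nat) : ~~ (p %| d)%N -> pint d%:R^-1.
Proof.
move=> pd; exists d; split=> //; exists 1; rewrite mulVf // pnatr_eq0.
by apply: contraNneq pd => ->.
Qed.

Lemma pmul_pint r : pmul r -> pint r.
Proof. by move=> [s hs ->]; apply: pintM => //; apply: pint_nat. Qed.

Lemma pmul0 : pmul 0. Proof. by exists 0; rewrite ?mulr0 //; exact: pint0. Qed.

Lemma pmulN r : pmul r -> pmul (- r).
Proof. by move=> [s hs ->]; exists (- s); [exact: pintN|ring]. Qed.

Lemma pmulD r s : pmul r -> pmul s -> pmul (r + s).
Proof. by move=> [u hu ->] [v hv ->]; exists (u + v); [exact: pintD|ring]. Qed.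

Lemma pmulB r s : pmul r -> pmul s -> pmul (r - s).
Proof. by move=> hr hs; apply: pmulD hr (pmulN hs). Qed.

Lemma pmulM r s : pint r -> pmul s -> pmul (r * s).
Proof. by move=> hr [u hu ->]; exists (r * u); [exact: pintM|ring]. Qed.

Lemma pmul_sum I (r : seq I) (P : pred I) (F : I -> rat) :
  (forall i, P i -> pmul (F i)) -> pmul (\sum_(i <- r | P i) F i).
Proof. by move=> h; apply: big_ind => //; [exact: pmul0|exact: pmulD]. Qed.

Lemma pmul_cancel (d : nat) r : ~~ (p %| d)%N -> pmul (d%:R * r) -> pmul r.
Proof.
move=> pd h; have -> : r = d%:R^-1 * (d%:R * r).
  by rewrite mulKf // pnatr_eq0; apply: contraNneq pd => ->.
by apply: pmulM h; apply: pint_invn.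
Qed.

Lemma rat_mul_natP r (d : nat) (z : int) : r * d%:R = z%:~R ->
  numq r * d%:Z = z * denq r.
Proof.
move=> e; apply: (@intr_inj rat); rewrite !intrM -e numqE.
by rewrite -pmulrn; ring.
Qed.

Lemma pint_denq r : pint r -> ~~ (p%:Z %| denq r)%Z.
Proof.
move=> [d [pd [z /rat_mul_natP e]]]; apply: contra pd => pden.
have : (denq r %| d%:Z)%Z.
  have : (denq r %| d%:Z * numq r)%Z by rewrite mulrC e dvdz_mull.
  by rewrite Gauss_dvdzl // coprimezE coprime_sym coprime_num_den.
by move/(dvdz_trans pden); rewrite dvdzE.
Qed.

Lemma pmul_numq r : pmul r -> (p%:Z %| numq r)%Z.
Proof.
move=> [s [d [pd [z e]]] er].
have : r * d%:R = (p%:Z * z)%:~R by rewrite er -mulrA e intrM.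
move/rat_mul_natP => e'; have : (p%:Z %| numq r * d%:Z)%Z.
  by rewrite e' -mulrA dvdz_mulr.
by rewrite Gauss_dvdzl // coprimezE /= prime_coprime.
Qed.

Definition pintF (x : fps rat) : Prop := forall n, pint (fcoef x n).

Lemma pintF_nat (m : nat) : pintF m%:R.
Proof.
move=> n; rewrite -[m%:R]mulr1 fcoef_natM fcoef1 -natrM; exact: pint_nat.
Qed.
Lemma pintF1 : pintF 1.
Proof. exact: (pintF_nat 1). Qed.
Lemma pintFD x y : pintF x -> pintF y -> pintF (x + y).
Proof. by move=> hx hy n; rewrite fcoefD; apply: pintD. Qed.
Lemma pintFN x : pintF x -> pintF (- x).
Proof. by move=> hx n; rewrite fcoefN; apply: pintN. Qed.
Lemma pintFB x y : pintF x -> pintF y -> pintF (x - y).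
Proof. by move=> hx hy n; rewrite fcoefB; apply: pintB. Qed.
Lemma pintFM x y : pintF x -> pintF y -> pintF (x * y).
Proof. by move=> hx hy n; rewrite fcoefM; apply: pint_sum => i _; apply: pintM. Qed.
Lemma pintFX x k : pintF x -> pintF (x ^+ k).
Proof.
move=> hx; elim: k => [|k IH]; first by rewrite expr0; exact: (pintF_nat 1).
by rewrite exprS; apply: pintFM.
Qed.
Lemma pintFC c : pint c -> pintF (fpsC c).
Proof. by move=> hc [|n]; [exact: hc|exact: pint0]. Qed.
Lemma pintF_deriv x : pintF x -> pintF (fderiv x).
Proof.
by move=> hx n; rewrite fcoef_deriv -mulr_natl; apply: pintM => //; exact: pint_nat.
Qed.

Definition pmulF (N : nat) (x : fps rat) : Prop :=
  forall i, (i <= N)%N -> pmul (fcoef x i).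

Lemma pmulFD N x y : pmulF N x -> pmulF N y -> pmulF N (x + y).
Proof. by move=> hx hy n nN; rewrite fcoefD; apply: pmulD; auto. Qed.
Lemma pmulFM N x y : pintF x -> pmulF N y -> pmulF N (x * y).
Proof.
move=> hx hy n nN; rewrite fcoefM; apply: pmul_sum => i _; apply: pmulM => //.
by apply: hy; rewrite (leq_trans (leq_subr _ _)).
Qed.
Lemma pmulF_p N x : pintF x -> pmulF N (p%:R * x).
Proof. by move=> hx n _; rewrite fcoef_natM; exists (fcoef x n). Qed.
Lemma pmulF_sum N I (r : seq I) (P : pred I) (F : I -> fps rat) :
  (forall i, P i -> pmulF N (F i)) -> pmulF N (\sum_(i <- r | P i) F i).
Proof.
move=> h; apply: big_ind => //; last exact: pmulFD.
by move=> n _; rewrite fcoef0; exact: pmul0.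
Qed.
Lemma pmulF_low N x : (forall i, (i <= N)%N -> fcoef x i = 0) -> pmulF N x.
Proof. by move=> h i iN; rewrite h //; exact: pmul0. Qed.

(** If the coefficients below [i] vanish modulo [p], multiplication by [c] is multiplication by its
    constant term in degree [i]; this isolates the indicial polynomial. *)
Lemma pmul_fcoefM c x i : pintF c -> (forall j, (j < i)%N -> pmul (fcoef x j)) ->
  pmul (fcoef (c * x) i - fcoef c 0 * fcoef x i).
Proof.
move=> hc hx; rewrite fcoefM big_ord_recl subn0 addrC addKr.
by apply: pmul_sum => j _; apply: pmulM => //; apply: hx; rewrite /= /bump;
  have := ltn_ord j; lia.
Qed.

End Localization.

Lemma fcoefM_low (R : comNzRingType) (x y : fps R) a b :
    (forall i, (i < a)%N -> fcoef x i = 0) ->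
    (forall i, (i < b)%N -> fcoef y i = 0) ->
  (forall i, (i < a + b)%N -> fcoef (x * y) i = 0) /\
  fcoef (x * y) (a + b) = fcoef x a * fcoef y b.
Proof.
move=> hx hy; split.
  move=> i iab; rewrite fcoefM big1 // => -[j /= ji] _.
  have [ja|aj] := ltnP j a; first by rewrite hx ?mul0r.
  by rewrite hy ?mulr0 //; lia.
have lt : (a < (a + b).+1)%N by lia.
rewrite fcoefM (bigD1 (Ordinal lt)) //= addKn big1 ?addr0 // => -[j /= jab].
rewrite -val_eqE /= => /eqP ja; have [jla|aj] := ltnP j a; first by rewrite hx ?mul0r.
by rewrite hy ?mulr0 //; lia.
Qed.

Definition DeltaF : fps rat := fpsC (1728%:R^-1) * (E4 * E4 * E4 - E6 * E6).

Lemma natr_fpsC_invM (R : numFieldType) (k : nat) (x : fps R) : (0 < k)%N ->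
  k%:R * (fpsC k%:R^-1 * x) = x.
Proof.
move=> k0; apply: fpsP => n; rewrite fcoef_natM fpsCM mulVKf //.
by rewrite pnatr_eq0 -lt0n.
Qed.

Lemma fcoef_fpsC_invM (R : numFieldType) (k : nat) (x : fps R) i : (0 < k)%N ->
  fcoef x i = k%:R -> fcoef (fpsC k%:R^-1 * x) i = 1.
Proof. by move=> k0 e; rewrite fpsCM e mulVf // pnatr_eq0 -lt0n. Qed.

Lemma DeltaFE : 1728%:R * DeltaF = E4 * E4 * E4 - E6 * E6.
Proof. exact: natr_fpsC_invM. Qed.

Lemma fderiv_fpsCM (R : comNzRingType) (c : R) (x : fps R) :
  fderiv (fpsC c * x) = fpsC c * fderiv x.
Proof. by rewrite fderivM fderivC mul0r add0r. Qed.

Lemma deriv_Delta : fderiv DeltaF = E2 * DeltaF.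
Proof.
rewrite /DeltaF fderiv_fpsCM mulrCA; congr (_ * _).
transitivity (E4 * E4 * (3 * fderiv E4) - E6 * (2 * fderiv E6)).
  by rewrite fderivB !fderivM; ring.
by rewrite deriv_E4 deriv_E6; ring.
Qed.

Lemma DeltaF_0 : fcoef DeltaF 0 = 0.
Proof.
rewrite /DeltaF fpsCM [X in _ * X](_ : _ = 0) ?mulr0 //.
by rewrite fcoefB 3!fcoefM0 E4_0 E6_0; ring.
Qed.

Lemma fcoefM1 (R : comNzRingType) (x y : fps R) :
  fcoef (x * y) 1 = fcoef x 0 * fcoef y 1 + fcoef x 1 * fcoef y 0.
Proof. by rewrite fcoefM big_ord_recr big_ord1. Qed.

Lemma DeltaF_1 : fcoef DeltaF 1 = 1.
Proof.
have div1 : divisors 1 = [:: 1%N] by [].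
have e4 : fcoef E4 1 = 240 by rewrite (E4_fcoef (ltn0Sn 0)) div1 big_seq1 expr1n mulr1.
have e6 : fcoef E6 1 = - 504 by rewrite (E6_fcoef (ltn0Sn 0)) div1 big_seq1 expr1n
  mulr1.
have E : fcoef (E4 * E4 * E4 - E6 * E6) 1 = 1728%:R.
  rewrite fcoefB (fcoefM1 (E4 * E4)) (fcoefM1 E4 E4) (fcoefM1 E6 E6) (fcoefM0 E4 E4).
  rewrite E4_0 E6_0 e4 e6; ring.
exact: fcoef_fpsC_invM.
Qed.

Lemma DeltaX_low m :
  (forall i, (i < m)%N -> fcoef (DeltaF ^+ m) i = 0) /\ fcoef (DeltaF ^+ m) m = 1.
Proof.
elim: m => [|m [IH1 IH2]]; first by rewrite expr0 fcoef1.
have D0 i : (i < 1)%N -> fcoef DeltaF i = 0 by case: i => // _; exact: DeltaF_0.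
by have := fcoefM_low D0 IH1; rewrite -exprS IH2 DeltaF_1 mulr1 add1n.
Qed.

Ltac pint_tac := repeat match goal with
  | |- pintF _ (GRing.add _ _) => apply: pintFD
  | |- pintF _ (GRing.opp _) => apply: pintFN
  | |- pintF _ (GRing.mul _ _) => apply: pintFM
  | |- pintF _ (GRing.exp _ _) => apply: pintFX
  | |- pintF _ (GRing.natmul _ _) => exact: pintF_nat
  | |- pintF _ (fderiv _) => apply: pintF_deriv
  | |- pintF _ 1 => apply: pintF1
  | |- _ => assumption
  end.

Lemma opAM x y : opA (x * y) = 12 * E4 * fderiv x * y + x * opA y.
Proof. by rewrite /opA fderivM; ring. Qed.

Lemma opAD x y : opA (x + y) = opA x + opA y.
Proof. by rewrite /opA fderivD; ring. Qed.

Lemma opLB x y : opL (x - y) = opL x - opL y.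
Proof. by rewrite /opL /opA !(fderivB, fderivM); ring. Qed.

Lemma opLD x y : opL (x + y) = opL x + opL y.
Proof. by rewrite /opL !opAD; ring. Qed.

Lemma opL_fpsC c x : opL (fpsC c * x) = fpsC c * opL x.
Proof.
have A y : opA (fpsC c * y) = fpsC c * opA y by rewrite opAM fderivC; ring.
by rewrite /opL !A; ring.
Qed.

Lemma opL_sum I (r : seq I) (F : I -> fps rat) :
  opL (\sum_(i <- r) F i) = \sum_(i <- r) opL (F i).
Proof.
apply: (big_morph opL opLD).
have -> : (0 : fps rat) = fpsC 0 * 0 by rewrite mulr0.
by rewrite opL_fpsC; apply: fpsP => n; rewrite !fpsCM !mul0r.
Qed.

(** At [q = 0] the operator becomes [144 D^2 - 48 D], whose indicial polynomial is
    [48 i (3 i - 1)]. *)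
Lemma opL_expand x : exists c1 c0 : fps rat,
  [/\ opL x = 144 * E4 * E4 * fderiv (fderiv x) + c1 * fderiv x + c0 * x,
      fcoef c1 0 = -48, fcoef c0 0 = 0 &
      forall p, prime p -> pintF p E2 -> pintF p E4 -> pintF p E6 ->
        pintF p c1 /\ pintF p c0].
Proof.
pose g := E2 * E4 - E6.
exists (144 * (E4 * fderiv E4) - 24 * (E4 * g) - 12 * (E4 * (6 * (E2 * E4) - 2 * E6))),
  (g * g - 12 * (E4 * fderiv g) + (6 * (E2 * E4) - 2 * E6) * g + 3 * (E4 * E4 * E4 -
    E6 * E6)).
split.
- by rewrite /opL /opA -/g !(fderivB, fderivM, fderiv_nat); ring.
- by rewrite /g !(E2_0, E4_0, E6_0, fderiv_fcoef0, fcoefB, fcoef_natM, fcoefM0); ring.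
- by rewrite /g !(E2_0, E4_0, E6_0, fderiv_fcoef0, fcoefB, fcoefD, fcoef_natM,
    fcoefM0); ring.
move=> p pp h2 h4 h6.
have hg : pintF p g by apply: pintFB => //; apply: pintFM.
by split; pint_tac.
Qed.

Section FpsConstants.
Variable R : comNzRingType.
Implicit Types c d : R.

Lemma fpsCD c d : fpsC (c + d) = fpsC c + fpsC d.
Proof. by apply: fpsP => -[|k]; rewrite fcoefD /fcoef /= ?addr0. Qed.
Lemma fpsCN c : fpsC (- c) = - fpsC c.
Proof. by apply: fpsP => -[|k]; rewrite fcoefN /fcoef /= ?oppr0. Qed.
Lemma fpsCMm c d : fpsC (c * d) = fpsC c * fpsC d.
Proof. by apply: fpsP => -[|k]; rewrite fpsCM /fcoef /= ?mulr0. Qed.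
Lemma fpsC1 : fpsC (1 : R) = 1.
Proof. by apply: fpsP => -[|k]; rewrite fcoef1. Qed.
Lemma fpsC_nat k : fpsC (k%:R : R) = k%:R.
Proof.
elim: k => [|k IH]; first by apply: fpsP => -[|j]; rewrite fcoef0.
by rewrite -!natr1 fpsCD IH fpsC1.
Qed.
Lemma natr_fpsC k (x : fps R) : k%:R * x = fpsC k%:R * x.
Proof. by rewrite fpsC_nat. Qed.
(** This and the next two lemmas turn the constants [alpha m] and [beta m] into natural-number
    expressions in the ring of series, where [ring] can expand them. *)
Lemma fpsC_poly2 (a b c d e m : nat) :
  fpsC (a%:R * (b%:R * m%:R + c%:R) * (d%:R * m%:R + e%:R) : R) =
  a%:R * (b%:R * m%:R + c%:R) * (d%:R * m%:R + e%:R).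
Proof. by rewrite !(fpsCMm, fpsCD, fpsC_nat). Qed.
Lemma fpsC_poly2B (a b c d e m : nat) :
  fpsC (a%:R * (b%:R * m%:R - c%:R) * (d%:R * m%:R + e%:R) : R) =
  a%:R * (b%:R * m%:R - c%:R) * (d%:R * m%:R + e%:R).
Proof. by rewrite !(fpsCMm, fpsCD, fpsCN, fpsC_nat). Qed.
Lemma fpsC_poly1B (a b c m : nat) :
  fpsC (a%:R * m%:R * (b%:R * m%:R - c%:R) : R) =
  a%:R * m%:R * (b%:R * m%:R - c%:R).
Proof. by rewrite !(fpsCMm, fpsCD, fpsCN, fpsC_nat). Qed.
End FpsConstants.

(** * Comparison of [theta] with the hypergeometric combination modulo [p] *)

Section Congruence.
Variables (p n : nat) (b : bool).
Hypothesis p_prime : prime p.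
Hypothesis p_ge5 : (4 < p)%N.
Hypothesis p_eq : (p.+1 = 12 * n + 6 * b)%N.

Lemma pint_sigma k : pintF p (sigma k).
Proof.
move=> m; have [->|m0] := posnP m; first by rewrite sigma_fcoef0; exact: pint0.
rewrite sigma_fcoef //; apply: (pint_sum p_prime) => d _; rewrite -natrX;
  exact: pint_nat.
Qed.

Lemma pint_E2 : pintF p E2.
Proof. by rewrite E2.unlock; pint_tac; exact: pint_sigma. Qed.
Lemma pint_E4 : pintF p E4.
Proof. by rewrite E4.unlock; pint_tac; exact: pint_sigma. Qed.
Lemma pint_E6 : pintF p E6.
Proof. by rewrite E6.unlock; pint_tac; exact: pint_sigma. Qed.

Lemma pint_Delta : pintF p DeltaF.
Proof.
have h4 := pint_E4; have h6 := pint_E6.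
rewrite /DeltaF; pint_tac; apply: pintFC => //; apply: pint_invn => //.
have -> : 1728%N = (2 ^ 6 * 3 ^ 3)%N by [].
rewrite Euclid_dvdM // !Euclid_dvdX // !dvdn_prime2 //.
by move: p_ge5; case: p => [|[|[|[]]]].
Qed.

Definition Ym (m : nat) : fps rat := E4 ^+ (3 * (n - m)) * DeltaF ^+ m.

Lemma pint_Ym m : pintF p (Ym m).
Proof. by rewrite /Ym; pint_tac; [exact: pint_E4|exact: pint_Delta]. Qed.

Lemma deriv_Delta_exp m : fderiv (DeltaF ^+ m) = m%:R * E2 * DeltaF ^+ m.
Proof.
elim: m => [|m IH]; first by rewrite expr0 fderiv1; ring.
by rewrite exprS fderivM IH deriv_Delta -natr1; ring.
Qed.

Lemma deriv_Ym m : (m <= n)%N ->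
  E4 * fderiv (Ym m) = (3 * (n%:R - m%:R) * fderiv E4 + m%:R * E2 * E4) * Ym m.
Proof.
move=> mn; rewrite /Ym fderivM deriv_Delta_exp -natrB //.
have := fderivX E4 (3 * (n - m)); rewrite natrM.
set x := fderiv _; set y := E4 ^+ _; set z := DeltaF ^+ m => e.
transitivity ((x * E4) * z + m%:R * E2 * E4 * (y * z)); first by ring.
by rewrite e; ring.
Qed.

Definition Xm (m : nat) : fps rat := E6 ^+ b * Ym m.

Definition alpha (m : nat) : rat := 48 * m%:R * (3 * m%:R - 1).
Definition beta (m : nat) : rat :=
  if b then 3 * (12 * m%:R + 5) * (4 * m%:R + 3)
  else 3 * (12 * m%:R - 1) * (4 * m%:R + 1).

(* Modulo [p] one has [12 n = 1 - 6 b], so that under derivations [E4 ^ (3 n)]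
   behaves like [E4 ^ (1/4 - 3 b/2)]; hence [opL] acts on [Xm m] as the
   hypergeometric operator acts on [z ^ m]. *)
Lemma opL_Xm m : (m <= n)%N -> exists2 W, pintF p W &
  opL (Xm m) = E6 ^+ b * (fpsC (alpha m) * (E4 ^+ 3 * Ym m)
                          - fpsC (beta m) * ((E4 * E4 * E4 - E6 * E6) * Ym m)) + p%:R
                              * W.
Proof.
move=> mn; have eY := deriv_Ym mn; have h4 := deriv_E4; have h6 := deriv_E6.
have i2 := pint_E2; have i4 := pint_E4; have i6 := pint_E6.
have iY := pint_Ym m.
(* This replaces [12 n] by [1 - 6 b], at the price of terms with a factor [p]. *)
have hn : 12 * n%:R + 6 * b%:R = p%:R + 1 :> fps rat.
  by rewrite -!natrM -natrD -p_eq -natr1.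
have AY : opA (Ym m) =
    (12 * m%:R * E6 - 6 * b%:R * (E2 * E4 - E6) + 3 * p%:R * fderiv E4) * Ym m.
  apply: (eq_by_sub (congr1 (fun x => 12 * x) eY)).
  apply: (eq_by_sub (congr1 (fun x => 3 * fderiv E4 * Ym m * x) hn)).
  apply: (eq_by_sub (congr1 (fun x => (1 - 12 * m%:R - 6 * b%:R) * Ym m * x) h4)).
  by rewrite /opA; ring.
rewrite /Xm /alpha /beta; case: (b) hn AY => /= _ AY.
  (* [W] collects what two applications of [opA] leave with a factor [p]; each of its terms
     therefore contains a derivative of [E4]. *)
  exists (Ym m * (36 * (E4 * (fderiv E6 * fderiv E4 + E6 * fderiv (fderiv E4)))
    + 3 * fderiv E4 * ((12 * m%:R + 6) * E6 * E6 - 6 * E4 * E4 * E4)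
    + 3 * E6 * fderiv E4 * (12 * m%:R * E6 - 6 * (E2 * E4 - E6))
    + 9 * p%:R * E6 * fderiv E4 * fderiv E4
    - (6 * E2 * E4 - 2 * E6) * (3 * E6 * fderiv E4))).
    by rewrite -!natrM; pint_tac.
  have AX : opA (E6 * Ym m) = ((12 * m%:R + 6) * E6 * E6 - 6 * E4 * E4 * E4
      + 3 * p%:R * (E6 * fderiv E4)) * Ym m.
    rewrite opAM AY; apply: (eq_by_sub (congr1 (fun x => 6 * E4 * Ym m * x) h6)).
    by ring.
  rewrite expr1 /opL AX opAM AY.
  rewrite (fpsC_poly1B _ 48 3 1) (fpsC_poly2 _ 3 12 5 4 3).
  rewrite !(fderivB, fderivD, fderivM, fderiv_nat, fderiv1).
  apply: (eq_by_sub (congr1 (fun x => Ym m * 12 * E4 * (12 * m%:R + 6) * E6 * x) h6)).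
  apply: (eq_by_sub (congr1 (fun x => - 72 * Ym m * E4 * E4 * E4 * x) h4)).
  by ring.
exists (Ym m * (36 * E4 * fderiv (fderiv E4) + 72 * m%:R * E6 * fderiv E4
  + 9 * p%:R * fderiv E4 * fderiv E4 - (6 * E2 * E4 - 2 * E6) * (3 * fderiv E4))).
  by pint_tac.
rewrite expr0 !mul1r /opL AY opAM AY.
rewrite (fpsC_poly1B _ 48 3 1) (fpsC_poly2B _ 3 12 1 4 1).
rewrite !(fderivB, fderivD, fderivM, fderiv_nat, fderiv1).
apply: (eq_by_sub (congr1 (fun x => 72 * m%:R * E4 * Ym m * x) h6)).
by ring.
Qed.

Lemma Xm_low m : (forall i, (i < m)%N -> fcoef (Xm m) i = 0) /\ fcoef (Xm m) m = 1.
Proof.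
have [D1 D2] := DeltaX_low m.
have -> : Xm m = (E6 ^+ b * E4 ^+ (3 * (n - m))) * DeltaF ^+ m by rewrite /Xm /Ym mulrA.
have [|h1 h2] := @fcoefM_low _ (E6 ^+ b * E4 ^+ (3 * (n - m))) _ 0 m _ D1; first by [].
by rewrite -[m in fcoef _ m]add0n h2 D2 fcoefM0 !fcoefX0 E6_0 E4_0 !expr1n !mulr1.
Qed.

Lemma pint_Xm m : pintF p (Xm m).
Proof. by rewrite /Xm; pint_tac; [exact: pint_E6|exact: pint_Ym]. Qed.

(** The expansion coefficients in powers of [Delta / E4^3]; the factor [1728] in their recursion
    comes from [E4^3 - E6^2 = 1728 Delta]. *)
Variable h : nat -> rat.
Hypothesis h0 : h 0%N = 1.
Hypothesis h_rec : forall m, (m < n)%N ->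
  alpha m.+1 * h m.+1 = 1728%:R * beta m * h m.

Lemma not_dvd_lt k : (0 < k)%N -> (k < p)%N -> ~~ (p %| k)%N.
Proof. by move=> k0 kp; rewrite gtnNdvd. Qed.

Lemma not_dvd_48 : ~~ (p %| 48)%N.
Proof.
have -> : 48%N = (2 ^ 4 * 3)%N by [].
rewrite Euclid_dvdM // !Euclid_dvdX // !dvdn_prime2 //.
by move: p_ge5; case: p => [|[|[|[]]]].
Qed.

Lemma alpha_nat m : alpha m.+1 = (48 * m.+1 * (3 * m + 2))%:R.
Proof. by rewrite /alpha -natr1 !natrM natrD natrM -natr1; ring. Qed.

(** Both [m + 1] and [3 m + 2] are positive and at most [3 n], hence below [p = 12 n + 6 b - 1]. *)
Lemma not_dvd_alpha m : (m < n)%N -> ~~ (p %| 48 * m.+1 * (3 * m + 2))%N.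
Proof.
move=> mn; apply: pint_dvdnM => //; last by apply: not_dvd_lt; lia.
by apply: pint_dvdnM => //; [exact: not_dvd_48|apply: not_dvd_lt; lia].
Qed.

Lemma pint_beta m : pint p (beta m).
Proof.
rewrite /beta; case: (b); repeat match goal with
  | |- pint _ (GRing.add _ _) => apply: pintD => //
  | |- pint _ (GRing.opp _) => apply: pintN
  | |- pint _ (GRing.mul _ _) => apply: pintM => //
  | |- pint _ (GRing.natmul _ _) => exact: pint_nat
  | |- pint _ 1 => exact: pint1
  end.
Qed.

Lemma pint_h m : (m <= n)%N -> pint p (h m).
Proof.
elim: m => [_|m IH mn]; first by rewrite h0; exact: pint1.
have d0 : (48 * m.+1 * (3 * m + 2))%:R != 0 :> rat by rewrite pnatr_eq0; lia.
have -> : h m.+1 = (48 * m.+1 * (3 * m + 2))%:R^-1 * (1728%:R * beta m * h m).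
  by rewrite -(h_rec mn) alpha_nat (mulKf d0).
apply: pintM => //; first by apply: pint_invn => //; exact: not_dvd_alpha.
apply: pintM => //; last exact/IH/ltnW.
by apply: pintM => //; [exact: pint_nat|exact: pint_beta].
Qed.

Definition Phi : fps rat := \sum_(m < n.+1) fpsC (h m) * Xm m.

(** Because [E4^3 Ym (m + 1) = Delta Ym m], the recursion cancels the [alpha] term of index [m + 1]
    against the [beta] term of index [m]. The [alpha] term of index 0 is zero, and the remaining
    [beta] term of index [n] is a multiple of [Delta^(n+1)], so it starts beyond [q^n]. *)
Lemma opL_Phi : pmulF p n (opL Phi).
Proof.
pose main m := E6 ^+ b * (fpsC (alpha m) * (E4 ^+ 3 * Ym m)
                    - fpsC (beta m) * ((E4 * E4 * E4 - E6 * E6) * Ym m)).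
have -> : opL Phi = \sum_(m < n.+1) fpsC (h m) * (opL (Xm m) - main m) +
    \sum_(m < n.+1) fpsC (h m) * main m.
  rewrite -big_split /= opL_sum; apply: eq_bigr => m _.
  by rewrite opL_fpsC -mulrDr subrK.
apply: pmulFD => //.
  apply: pmulF_sum => // -[m /= mn] _; apply: pmulFM => //.
    by apply: pintFC => //; apply: pint_h.
  have [W hW ->] := opL_Xm mn.
  by rewrite [X in pmulF _ _ (X - _)]addrC addrK; apply: pmulF_p.
have [c hD hrec] : exists2 c : fps rat, E4 * E4 * E4 - E6 * E6 = c * DeltaF &
    forall m, (m < n)%N ->
      fpsC (alpha m.+1) * fpsC (h m.+1) = c * fpsC (beta m) * fpsC (h m).
  exists (fpsC 1728%:R); first exact: etrans (esym DeltaFE) (natr_fpsC 1728 DeltaF).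
  move=> m mn; apply: etrans (esym (fpsCMm (alpha m.+1) (h m.+1))) _.
  apply: etrans (congr1 (@fpsC _) (h_rec mn)) _.
  apply: etrans (fpsCMm (1728%:R * beta m) (h m)) _.
  exact (congr1 (fun z : fps rat => z * fpsC (h m)) (fpsCMm 1728%:R (beta m))).
have a0 : fpsC (alpha 0) = 0.
  by rewrite /alpha mulr0 mul0r; apply: fpsP => -[].
pose A m := fpsC (alpha m) * fpsC (h m) * (E4 ^+ 3 * Ym m).
pose B m := c * fpsC (beta m) * fpsC (h m) * (DeltaF * Ym m).
have -> : \sum_(m < n.+1) fpsC (h m) * main m =
    E6 ^+ b * (\sum_(m < n.+1) A m - \sum_(m < n.+1) B m).
  rewrite -sumrB mulr_sumr; apply: eq_bigr => m _.
  by rewrite /main /A /B hD; ring.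
have -> : \sum_(m < n.+1) A m - \sum_(m < n.+1) B m = - B n.
  rewrite big_ord_recl [X in _ - X]big_ord_recr /= {1}/A a0 mul0r mul0r add0r.
  rewrite (eq_bigr (fun i : 'I_n => B i)); last first.
    move=> [m mn] _; rewrite /A /B /= /bump /= add1n hrec //; congr (_ * _).
    rewrite /Ym (_ : 3 * (n - m) = 3 + 3 * (n - m.+1))%N; last by lia.
    by rewrite exprD [DeltaF ^+ m.+1]exprS; ring.
  by rewrite opprD addrA subrr add0r.
apply: pmulF_low => // i iN.
have -> : E6 ^+ b * - B n = - (E6 ^+ b * (c * fpsC (beta n) * fpsC (h n))) * DeltaF
  ^+ n.+1.
  by rewrite /B /Ym subnn muln0 expr0 exprS; ring.
have [D1 _] := DeltaX_low n.+1.
move: (- _) => z; have [|h1 _] := @fcoefM_low _ z _ 0 n.+1 _ D1; first by [].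
exact: h1.
Qed.

(** Frobenius' method modulo [p]: if the coefficients of the difference [d] below [i] vanish modulo
    [p], that of [opL d] in degree [i] is [48 i (3 i - 1)] times that of [d], and this factor is
    prime to [p] for [0 < i <= n]. *)
Lemma theta_Phi : pmulF p n (theta - Phi).
Proof.
set d := theta - Phi.
have Ld : pmulF p n (opL d).
  rewrite /d opLB opL_theta sub0r => i iN; rewrite fcoefN; apply: pmulN => //.
  exact: opL_Phi.
have d0 : fcoef d 0 = 0.
  rewrite /d fcoefB theta_0 /Phi fcoef_sum big_ord_recl fpsCM h0 mul1r.
  have [_ ->] := Xm_low 0.
  rewrite big1 ?addr0 ?subrr // => i _; rewrite fpsCM.
  by have [e _] := Xm_low (lift ord0 i); rewrite e ?mulr0.
move: d Ld d0 => d Ld d0.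
have [c1 [c0 [eL c10 c00 hc]]] := opL_expand d.
have [ic1 ic0] := hc p p_prime pint_E2 pint_E4 pint_E6.
elim/ltn_ind => i IH iN; have [->|i0] := posnP i; first by rewrite d0; exact: pmul0.
have IH' j : (j < i)%N -> pmul p (fcoef d j) by move=> ji;
  exact: IH ji (leq_trans (ltnW ji) iN).
have I1 j : (j < i)%N -> pmul p (fcoef (fderiv d) j).
  by move=> ji; rewrite fcoef_deriv -[_ *+ j]mulr_natl;
    exact: pmulM (pint_nat p_prime j) (IH' j ji).
have I2 j : (j < i)%N -> pmul p (fcoef (fderiv (fderiv d)) j).
  by move=> ji; rewrite fcoef_deriv -[_ *+ j]mulr_natl;
    exact: pmulM (pint_nat p_prime j) (I1 j ji).
have i44 : pintF p (144 * E4 * E4).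
  by have i4 := pint_E4; pint_tac.
have := Ld i iN; rewrite eL !fcoefD => H.
have H1 := pmul_fcoefM p_prime ic1 I1; have H2 := pmul_fcoefM p_prime i44 I2.
have H0 := pmul_fcoefM p_prime ic0 IH'.
have := pmulB p_prime (pmulB p_prime (pmulB p_prime H H2) H1) H0.
rewrite c10 c00 fcoefM0 E4_0 fcoef_natM E4_0 !fcoef_deriv.
set u := fcoef d i; set x := fcoef (_ * _ * _) i; set y := fcoef (c1 * _) i;
  set z := fcoef (c0 * _) i.
have -> : x + y + z - (x - 144 * 1 * 1 * (u *+ i *+ i)) - (y - -48 * (u *+ i)) - (z -
  0 * u)
   = (48 * (i * (3 * i - 1)))%:R * u.
  have i31 : (1 <= 3 * i)%N by lia.
  by rewrite (natrM _ 48) (natrM _ i) (natrB _ i31) (natrM _ 3); ring.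
apply: (pmul_cancel p_prime).
apply: (pint_dvdnM p_prime); first exact: not_dvd_48.
by apply: (pint_dvdnM p_prime); apply: not_dvd_lt; lia.
Qed.

(** The series [Xm m] is [p]-integral and begins with [q^m], so the system is solved from the
    bottom. The [p]-integrality of [g] is not assumed; it follows. *)
Lemma coef_congr (g : nat -> rat) :
    (forall i, (i <= n)%N ->
       fcoef theta i = fcoef (\sum_(m < n.+1) fpsC (g m) * Xm m) i) ->
  forall m, (m <= n)%N -> pmul p (g m - h m).
Proof.
move=> hg.
have G i : (i <= n)%N -> pmul p (fcoef (\sum_(m < n.+1) fpsC (g m - h m) * Xm m) i).
  move=> iN; have := theta_Phi iN; rewrite fcoefB hg // /Phi -fcoefB -sumrB.
  congr (pmul p (fcoef _ i)); apply: eq_bigr => m _.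
  by rewrite fpsCD fpsCN mulrBl.
elim/ltn_ind => m IH mn.
have mn' : (m < n.+1)%N by [].
have := G m mn; rewrite fcoef_sum (bigD1 (Ordinal mn')) //= fpsCM.
have [_ ->] := Xm_low m; rewrite mulr1 => H.
rewrite -[_ - _](addrK (\sum_(i < n.+1 | i != Ordinal mn') fcoef (fpsC (g i - h i) *
  Xm i) m)).
apply: pmulB => //; apply: pmul_sum => // -[i /= iN]; rewrite -val_eqE /= => im.
rewrite fpsCM; have [lt|gt|e] := ltngtP i m.
- by rewrite mulrC; apply: pmulM => //; [exact: pint_Xm|apply: IH].
- by have [e _] := Xm_low i; rewrite e // mulr0; exact: pmul0.
- by rewrite e eqxx in im.
Qed.

End Congruence.

(** * Norms of Eisenstein integers *)

(* [(x, y)] stands for [x + y zeta] with [zeta ^ 2 = zeta - 1]. *)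
Definition eis_norm (x : int * int) : int := x.1 ^+ 2 + x.2 ^+ 2 + x.1 * x.2.
Definition eis_mul (x y : int * int) : int * int :=
  (x.1 * y.1 - x.2 * y.2, x.1 * y.2 + x.2 * y.1 + x.2 * y.2).
(** The conjugate of [zeta] is [1 - zeta]. *)
Definition eis_conj (x : int * int) : int * int := (x.1 + x.2, - x.2).

Lemma eis_norm_mul x y : eis_norm (eis_mul x y) = eis_norm x * eis_norm y.
Proof. by case: x y => [x1 x2] [y1 y2]; rewrite /eis_norm /eis_mul /=; ring. Qed.

Lemma eis_norm_conj x : eis_norm (eis_conj x) = eis_norm x.
Proof. by case: x => [x1 x2]; rewrite /eis_norm /eis_conj /=; ring. Qed.

Lemma eis_mulC : commutative eis_mul.
Proof. by move=> [x1 x2] [y1 y2]; rewrite /eis_mul /=; congr pair; ring. Qed.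

Lemma eis_mulA : associative eis_mul.
Proof. by move=> [x1 x2] [y1 y2] [z1 z2]; rewrite /eis_mul /=; congr pair; ring. Qed.

Lemma eis_mul_conj x : eis_mul x (eis_conj x) = (eis_norm x, 0).
Proof. by case: x => [x1 x2]; rewrite /eis_mul /eis_norm /eis_conj /=; congr pair;
  ring. Qed.

Lemma eis_mul_scal c x : eis_mul (c, 0) x = (c * x.1, c * x.2).
Proof. by rewrite /eis_mul /=; congr pair; ring. Qed.

Lemma eis_mulI z : eis_norm z != 0 -> injective (eis_mul z).
Proof.
move=> z0 x y /(congr1 (eis_mul (eis_conj z))).
rewrite !eis_mulA [eis_mul _ z]eis_mulC eis_mul_conj !eis_mul_scal.
by case: x y => [x1 x2] [y1 y2] /= [/(mulfI z0) -> /(mulfI z0) ->].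
Qed.

Section ModPrime.
Variable p : nat.
Hypothesis p_prime : prime p.

Lemma Fp_dvdz (m : int) : (p %| m)%Z = (m%:~R == 0 :> 'F_p).
Proof. exact: (dvdz_pcharf (pchar_Fp p_prime)). Qed.

Lemma Fp_expS (x : 'F_p) : x ^+ p = x.
Proof. by have := expf_card x; rewrite card_Fp. Qed.

Lemma prime_dvdzM (m n : int) : (p %| m * n)%Z = (p %| m)%Z || (p %| n)%Z.
Proof. by rewrite !Fp_dvdz rmorphM /= mulf_eq0. Qed.

Lemma dvdz_norm_snd x : (p %| eis_norm x)%Z -> (p %| x.2)%Z -> (p %| x.1)%Z.
Proof.
rewrite !Fp_dvdz /eis_norm !expr2 !intrD !intrM => h /eqP x2; move: h.
by rewrite x2 !mulr0 !addr0 mulf_eq0 orbb.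
Qed.

(** In ['F_p] a zero of the norm satisfies [X^3 = Y^3]. As [p - 1] is 1 modulo 3, Fermat's theorem
    then gives [X = Y], and the norm is [3 Y^2]. *)
Lemma eis_inert x : p = 2 %[mod 3] -> (p %| eis_norm x)%Z ->
  (p %| x.1)%Z /\ (p %| x.2)%Z.
Proof.
move=> p3 px; suff: (p %| x.2)%Z by split=> //; exact: dvdz_norm_snd.
move: px; rewrite !Fp_dvdz /eis_norm !expr2 !intrD !intrM -!expr2.
move: (x.1%:~R) (x.2%:~R) => X Y /eqP h; apply: contraT => Y0.
have X0 : X != 0.
  by apply: contraNneq Y0 => X0; move: h;
    rewrite X0 expr0n mul0r add0r addr0 => /eqP; rewrite expf_eq0.
have h3 : X ^+ 3 = Y ^+ 3.
  apply/eqP; rewrite -subr_eq0; apply/eqP.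
  by transitivity ((X - Y) * (X ^+ 2 + Y ^+ 2 + X * Y)); [ring|rewrite h mulr0].
have F1 (Z : 'F_p) : Z != 0 -> Z ^+ p.-1 = 1.
  move=> Z0; apply: (mulfI Z0); rewrite -exprS prednK ?prime_gt0 // Fp_expS mulr1 //.
have ep : p.-1 = (3 * (p %/ 3)).+1 by have := prime_gt0 p_prime; lia.
have XY : X = Y.
  have := etrans (F1 X X0) (esym (F1 Y Y0)); rewrite ep !exprSr (exprM X) (exprM Y) h3.
  by apply: mulfI; rewrite !expf_neq0.
have : 3%:R * Y ^+ 2 = 0 by rewrite -h XY; ring.
move/eqP; rewrite mulf_eq0 expf_eq0 (negPf Y0) andbF orbF.
rewrite -(dvdn_pcharf (pchar_Fp p_prime)) dvdn_prime2 // => /eqP e.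
by rewrite e in p3.
Qed.

(** With [m = (p - 1) / 3], the polynomial [X^m - 1] has too few roots to vanish on all of the
    nonzero residues; for [x] not a root, [x^m] is a primitive cube root of unity. *)
Lemma Fp_cube_root : p = 1 %[mod 3] -> exists t : int, (p %| t ^+ 2 + t + 1)%Z.
Proof.
move=> p3; pose m := (p.-1 %/ 3)%N.
have p1 := prime_gt1 p_prime.
have ep : p.-1 = (3 * m)%N by rewrite /m; lia.
have m0 : (0 < m)%N by lia.
pose rs := enum (predC1 (0 : 'F_p)).
have srs : size rs = p.-1 by rewrite -cardE cardC1 card_Fp.
have [/allP hall|] := boolP (all m.-unity_root rs).
  have := max_unity_roots m0 (introT allP hall).
  rewrite enum_uniq srs => /(_ isT); lia.
case/allPn => x; rewrite mem_enum inE => x0; rewrite unity_rootE => xm.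
pose y := x ^+ m.
have y3 : y ^+ 3 = 1.
  apply: (mulfI x0); rewrite /y -exprM mulnC -ep -exprS prednK ?prime_gt0 //.
  by rewrite Fp_expS mulr1.
exists (y : nat)%:Z; rewrite Fp_dvdz !rmorphD rmorphXn /= -pmulrn.
have -> : (y : nat)%:R = y by rewrite natr_Zp.
have : (y - 1) * (y ^+ 2 + y + 1) = 0 by transitivity (y ^+ 3 - 1);
  [ring|rewrite y3 subrr].
by move/eqP; rewrite mulf_eq0 subr_eq0 (negPf xm).
Qed.

End ModPrime.

(** Descent. A shift [s] of [t] by a multiple of [N] has [|2 s + 1| <= N], so the norm of [(s, 1)]
    is [N N'] with [N' < N]. A factor of norm [N'] has a cofactor of norm [N], which also divides
    [(t, 1)]. Asking for a divisor of [(t, 1)], and not just for an element of norm [N], is what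
    makes the induction work. *)
Lemma eis_norm_root N : (0 < N)%N -> forall t : int, (N %| eis_norm (t, 1))%Z ->
  exists z w, eis_norm z = N%:Z /\ eis_mul z w = (t, 1).
Proof.
elim/ltn_ind: N => N IH N0 t Nt.
have [N1|N1] := leqP N 1.
  have -> : N = 1%N by lia.
  by exists (1, 0), (t, 1); rewrite /eis_norm /eis_mul /=; split; [|congr pair]; ring.
have [k hk] : exists k : int, - N%:Z <= 2 * (t + k * N%:Z) + 1 <= N%:Z.
  exists (- ((t + (N %/ 2)%N%:Z) %/ N%:Z)%Z).
  have := divz_eq (t + (N %/ 2)%N%:Z) N%:Z.
  have : 0 <= ((t + (N %/ 2)%N%:Z) %% N%:Z)%Z by apply: modz_ge0; lia.
  have : ((t + (N %/ 2)%N%:Z) %% N%:Z)%Z < N%:Z by apply: ltz_pmod; lia.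
  move: (_ %% _)%Z (_ %/ N%:Z)%Z => r q *; lia.
set s := t + k * N%:Z in hk.
have /dvdzP[N' eN'] : (N %| eis_norm (s, 1))%Z.
  have -> : eis_norm (s, 1) = eis_norm (t, 1) + N%:Z * (2 * t * k + k * k * N%:Z + k).
    by rewrite /s /eis_norm /=; ring.
  by rewrite rpredD // dvdz_mulr.
have e4 : 4 * (N' * N%:Z) = (2 * s + 1) ^+ 2 + 3 by rewrite -eN' /eis_norm /=; ring.
have N'0 : 0 < N' by nia.
have N'N : N' < N%:Z by nia.
have eabs : N' = `|N'|%N%:Z by lia.
have ltN : (`|N'|%N < N)%N by lia.
have gt0 : (0 < `|N'|%N)%N by lia.
have [|z [w [nz zw]]] := IH _ ltN gt0 s; first by rewrite eN' -eabs dvdz_mulr.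
have nw : eis_norm w = N%:Z.
  have := congr1 eis_norm zw; rewrite eis_norm_mul nz eN' -eabs.
  by apply: mulfI; lia.
(* From [z w = (s, 1)] and [w (eis_conj w) = (N, 0)] one gets [w (z - k eis_conj w) = (s - k N, 1) =
   (t, 1)]. *)
exists w, (z.1 - k * (eis_conj w).1, z.2 - k * (eis_conj w).2); split=> //.
have := eis_mul_conj w; rewrite nw; have := zw; rewrite /s.
case: z w {nz zw nw} => [z1 z2] [w1 w2];
  rewrite /eis_mul /eis_conj /= => -[a1 a2] [b1 b2].
by congr pair; lia.
Qed.

Lemma normset_key : unit. Proof. exact: tt. Qed.

(** The box is large enough: an element of norm [N] has [x^2 + y^2 <= 2 N]. *)
Definition normset (N : nat) : {fset int * int} :=
  seq_fset normset_key
   [seq z <- [seq (x, y) | x <- [seq i%:Z - (2 * N)%N%:Z | i <- iota 0 (4 * N).+1],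
                           y <- [seq i%:Z - (2 * N)%N%:Z | i <- iota 0 (4 * N).+1]]
   | eis_norm z == N%:Z].

Lemma in_normset N z : (z \in normset N) = (eis_norm z == N%:Z).
Proof.
rewrite seq_fsetE mem_filter; have [e|//] := eqVneq; rewrite andTb.
have inB (x : int) : x ^+ 2 <= 2 * N%:Z ->
    x \in [seq i%:Z - (2 * N)%N%:Z | i <- iota 0 (4 * N).+1].
  move=> hx; have [h1 h2] : - (2 * N)%N%:Z <= x /\ x <= (2 * N)%N%:Z by split; nia.
  apply/mapP; exists (absz (x + (2 * N)%N%:Z)); first by rewrite mem_iota; lia.
  lia.
case: z e => x y e; have {}e : x ^+ 2 + y ^+ 2 + x * y = N%:Z := e.
by apply: allpairs_f; apply: inB; nia.
Qed.

Notation normset_num N := (#|` normset N|).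

Definition eis_units : seq (int * int) :=
  [:: (1, 0); (0, 1); (-1, 0); (0, -1); (1, -1); (-1, 1)].

Lemma eis_norm_eq1 (x y : int) : eis_norm (x, y) = 1 -> (x, y) \in eis_units.
Proof.
move=> e; have {}e : x ^+ 2 + y ^+ 2 + x * y = 1 := e.
have [hx1 hx2] : -1 <= x /\ x <= 1 by split; nia.
have [hy1 hy2] : -1 <= y /\ y <= 1 by split; nia.
have [ex|[ex|ex]] : x = -1 \/ x = 0 \/ x = 1 by lia.
all: have [ey|[ey|ey]] : y = -1 \/ y = 0 \/ y = 1 by lia.
all: by subst.
Qed.

Lemma normset1 : normset_num 1 = 6.
Proof.
suff -> : normset 1 = seq_fset normset_key eis_units by rewrite size_seq_fset.
apply/fsetP => -[x y]; rewrite in_normset seq_fsetE; apply/eqP/idP => [e|].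
  exact: eis_norm_eq1.
by rewrite !inE => /or4P[/eqP[-> ->]|/eqP[-> ->]|/eqP[-> ->]|/or3P[] /eqP[-> ->]].
Qed.

Definition eis_image (z : int * int) (N : nat) : {fset int * int} :=
  [fset eis_mul z w | w in normset N]%fset.

Lemma card_eis_image z N : eis_norm z != 0 -> #|` eis_image z N| = normset_num N.
Proof. by move=> z0; rewrite card_imfset //; exact: eis_mulI. Qed.

Lemma eis_image_sub z M N x : eis_norm z = M%:Z -> x \in eis_image z N ->
  x \in normset (M * N).
Proof.
by move=> nz /imfsetP[w /= +] ->; rewrite !in_normset eis_norm_mul nz => /eqP ->.
Qed.

(** The quotient of [x] by [z] is [eis_mul x (eis_conj z)] divided by the norm of [z]. *)
Lemma in_eis_image z (M N : nat) x : eis_norm z = M%:Z -> (0 < M)%N ->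
  x \in normset (M * N) ->
  (M %| (eis_mul x (eis_conj z)).1)%Z -> (M %| (eis_mul x (eis_conj z)).2)%Z ->
  x \in eis_image z N.
Proof.
move=> nz M0; rewrite in_normset => /eqP nx /dvdzP[a ea] /dvdzP[b eb].
have M0' : M%:Z != 0 :> int by lia.
have e : eis_mul x (eis_conj z) = eis_mul (M%:Z, 0) (a, b).
  by rewrite eis_mul_scal /= [LHS]surjective_pairing ea eb; congr pair; ring.
have ez : eis_mul z (a, b) = x.
  apply: (@eis_mulI (M%:Z, 0)); first by rewrite /eis_norm /=; lia.
  rewrite eis_mulA [eis_mul _ z]eis_mulC -eis_mulA -e eis_mulA eis_mulC.
  rewrite eis_mulA [eis_mul _ z]eis_mulC eis_mul_conj nz //.
apply/imfsetP; exists (a, b) => //=; rewrite in_normset; apply/eqP.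
have := congr1 eis_norm ez; rewrite eis_norm_mul nz nx PoszM.
exact: mulfI.
Qed.

(** The ramified prime: modulo 3 the norm is [(x - y)^2], so an element of norm divisible by 3 is a
    multiple of [(1, 1)], which has norm 3. *)
Lemma normset_mul3 N : normset_num (3 * N) = normset_num N.
Proof.
have n3 : eis_norm (1, 1) = 3%:Z by [].
rewrite -(@card_eis_image (1, 1) N) //; congr (#|` _|); apply/fsetP => x.
apply/idP/idP; last exact: (eis_image_sub n3).
move=> xN; apply: (@in_eis_image (1, 1) 3) => //; move: xN;
  rewrite in_normset /eis_norm /eis_mul /eis_conj /=.
  case: x => x y /= /eqP e.
  have : (3 %| (x - y) ^+ 2)%Z by apply/dvdzP; exists (N%:Z - x * y); lia.
  rewrite expr2 (@prime_dvdzM 3) // orbb => /dvdzP[k ek].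
  by apply/dvdzP; exists (2 * k + y); lia.
case: x => x y /= /eqP e.
have : (3 %| (x - y) ^+ 2)%Z by apply/dvdzP; exists (N%:Z - x * y); lia.
rewrite expr2 (@prime_dvdzM 3) // orbb => /dvdzP[k ek].
by apply/dvdzP; exists (- k); lia.
Qed.

Section Primes.
Variable p : nat.
Hypothesis p_prime : prime p.

Let p_gt0 : (0 < p)%N := prime_gt0 p_prime.

(** The multiples of [p] among the elements of norm [p N]. They are all of them for [p] inert, and
    the overlap of two sets of multiples for [p] split. *)
Definition scaled (N : nat) : {fset int * int} :=
  if (p %| N)%N then eis_image (p%:Z, 0) (N %/ p) else fset0.

Lemma card_scaled N :
  #|` scaled N| = if (p %| N)%N then normset_num (N %/ p) else 0.
Proof.
rewrite /scaled; case: ifP => // _; rewrite card_eis_image // /eis_norm /=.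
by have := p_gt0; nia.
Qed.

Lemma in_scaled N x : (x \in scaled N) =
  [&& x \in normset (p * N), (p %| x.1)%Z & (p %| x.2)%Z].
Proof.
have p0 : p%:Z != 0 :> int by have := p_gt0; lia.
have np : eis_norm (p%:Z, 0) = (p * p)%N%:Z by rewrite /eis_norm /=; lia.
rewrite /scaled; apply/idP/and3P.
  case: ifP => // /divnK e xi; split.
  - by have := eis_image_sub np xi; rewrite -mulnA [(p * (_ %/ _))%N]mulnC e.
  - by case/imfsetP: xi => w _ ->; rewrite eis_mul_scal dvdz_mulr.
  - by case/imfsetP: xi => w _ ->; rewrite eis_mul_scal dvdz_mulr.
move=> [xN /dvdzP[a ea] /dvdzP[b eb]].
have ex : x = eis_mul (p%:Z, 0) (a, b).
  by rewrite eis_mul_scal /= [LHS]surjective_pairing ea eb; congr pair; ring.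
have nab : N%:Z = p%:Z * eis_norm (a, b).
  move: xN; rewrite in_normset ex eis_norm_mul np => /eqP; rewrite !PoszM -mulrA.
  by move/(mulfI p0).
have pN : (p %| N)%N by rewrite -[(p %| N)%N]/(p %| N%:Z)%Z nab dvdz_mulr.
rewrite pN; apply/imfsetP; exists (a, b) => //=.
rewrite in_normset; apply/eqP/(mulfI p0); rewrite -nab -PoszM mulnC divnK //.
Qed.

Lemma normset_inert N : p = 2 %[mod 3] ->
  normset_num (p * N) = if (p %| N)%N then normset_num (N %/ p) else 0.
Proof.
move=> p3; rewrite -card_scaled; congr (#|` _|); apply/fsetP => x.
rewrite in_scaled; case: (boolP (x \in normset _)) => //= xN; apply/esym/andP.
apply: eis_inert => //; move: xN; rewrite in_normset => /eqP ->.
by rewrite PoszM dvdz_mulr.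
Qed.

(* If [p] is the norm of [z], an element of norm divisible by [p] is divisible by
   [z] or by its conjugate, and by both only if it is divisible by [p]. *)
Lemma normset_split N : p = 1 %[mod 3] ->
  (normset_num (p * N) + if (p %| N)%N then normset_num (N %/ p) else 0)%N =
  (2 * normset_num N)%N.
Proof.
move=> p3; have [t ht] := Fp_cube_root p_prime p3.
have [|z [_ [nz _]]] := @eis_norm_root p p_gt0 t.
  by move: ht; rewrite /eis_norm /= expr1n mulr1 addrAC.
have nz' : eis_norm (eis_conj z) = p%:Z by rewrite eis_norm_conj.
have p0 : p%:Z != 0 :> int by have := p_gt0; lia.
have cK : eis_conj (eis_conj z) = z.
  by case: (z) => a b; rewrite /eis_conj /=; congr pair; ring.
have -> : (2 * normset_num N)%N = (#|` eis_image z N| + #|` eis_image (eis_conj z)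
  N|)%N.
  by rewrite !card_eis_image ?nz ?nz' // mul2n addnn.
(* Inclusion-exclusion: the union of the multiples of [z] and of its conjugate is [normset (p * N)],
   the intersection is [scaled N]. *)
rewrite -cardfsUI -card_scaled; congr (_ + _)%N; congr (#|` _|); apply/fsetP => x.
  rewrite in_fsetU; apply/idP/orP => [xN|[|]];
    [|exact: (eis_image_sub nz)|exact: (eis_image_sub nz')].
  have nx : (p %| eis_norm x)%Z by move: (xN); rewrite in_normset PoszM => /eqP ->;
    rewrite dvdz_mulr.
  have key y : (p %| (eis_mul x y).2)%Z -> (p %| (eis_mul x y).1)%Z.
    by move=> h; apply: (dvdz_norm_snd p_prime _ h); rewrite eis_norm_mul dvdz_mulr.
  have : (p %| (eis_mul x (eis_conj z)).2 * (eis_mul x z).2)%Z.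
    have -> : (eis_mul x (eis_conj z)).2 * (eis_mul x z).2 =
        x.2 ^+ 2 * eis_norm z - z.2 ^+ 2 * eis_norm x.
      by rewrite /eis_mul /eis_conj /eis_norm /=; ring.
    by rewrite nz rpredB // dvdz_mull.
  rewrite prime_dvdzM // => /orP[h|h]; [left|right].
    by apply: (in_eis_image nz p_gt0 xN) => //; apply: key.
  by apply: (in_eis_image nz' p_gt0 xN); rewrite cK //; apply: key.
rewrite in_fsetI in_scaled; apply/and3P/andP.
  move=> [xN h1 h2].
  split; [apply: (in_eis_image nz p_gt0 xN)|apply: (in_eis_image nz' p_gt0 xN)];
    rewrite /eis_mul /=; repeat (first [apply: rpredB | apply: rpredD]);
    exact: dvdz_mulr.
move=> [xz xz']; have xN := eis_image_sub nz xz.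
have p3' : (p != 3)%N by apply/eqP => e; rewrite e in p3.
have dv w : eis_norm w = p%:Z -> x \in eis_image w N ->
    (p %| (eis_mul x (eis_conj w)).1)%Z /\ (p %| (eis_mul x (eis_conj w)).2)%Z.
  move=> nw /imfsetP[u _ ->]; rewrite eis_mulC eis_mulA [eis_mul _ w]eis_mulC.
  by rewrite eis_mul_conj nw eis_mul_scal !dvdz_mulr.
have [a1 a2] := dv _ nz xz; have [b1 b2] := dv _ nz' xz'; rewrite cK in b1 b2.
(* The trace of [z] is prime to [p]: otherwise [p] divides [3 z.2^2], hence both coordinates of [z],
   and [p^2] divides its norm [p]. Multiplying [x] by the trace is adding its products with [z] and
   with the conjugate. *)
have tr : ~~ (p %| 2 * z.1 + z.2)%Z.
  apply/negP => h; have : (p %| 3%:Z * (z.2 * z.2))%Z.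
    have -> : 3%:Z * (z.2 * z.2) = 4 * eis_norm z - (2 * z.1 + z.2) * (2 * z.1 + z.2).
      by rewrite /eis_norm; ring.
    by apply: rpredB; [rewrite nz dvdz_mull|exact: dvdz_mulr].
  rewrite !prime_dvdzM // orbb -[(p %| 3%:Z)%Z]/(p %| 3)%N dvdn_prime2 // (negPf p3')
    /=.
  move=> /dvdzP[d ed]; have /dvdzP[c ec] : (p %| z.1)%Z.
    by apply: dvdz_norm_snd; rewrite ?nz // ed dvdz_mull.
  have := nz; rewrite /eis_norm ec ed.
  have p1 := prime_gt1 p_prime => e.
  have : p%:Z * (p%:Z * (c ^+ 2 + d ^+ 2 + c * d)) = p%:Z * 1.
    by rewrite mulr1 -[RHS]e; ring.
  move/(mulfI p0) => e1; have : (p %| 1)%Z.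
    by apply/dvdzP; exists (c ^+ 2 + d ^+ 2 + c * d); rewrite mulrC e1.
  by rewrite dvdz1 absz_nat; move: p1; case: (p) => [|[|]].
have := rpredD a1 b1; have := rpredD a2 b2.
have -> : (eis_mul x (eis_conj z)).2 + (eis_mul x z).2 = (2 * z.1 + z.2) * x.2.
  by rewrite /eis_mul /eis_conj /=; ring.
have -> : (eis_mul x (eis_conj z)).1 + (eis_mul x z).1 = (2 * z.1 + z.2) * x.1.
  by rewrite /eis_mul /eis_conj /=; ring.
by rewrite !prime_dvdzM // (negPf tr).
Qed.

End Primes.

Lemma chi3M a b : chi3 (a * b) = chi3 a * chi3 b.
Proof.
rewrite /chi3 -modnMm.
have := ltn_pmod a (isT : 0 < 3)%N; have := ltn_pmod b (isT : 0 < 3)%N.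
by move: (a %% 3)%N (b %% 3)%N => [|[|[|]]] // [|[|[|]]].
Qed.

(** The divisors prime to [p] are the same for [p N] and [N]; the others are [p] times the divisors
    of [N] and of [N / p]. *)
Lemma sum_chi3_mul p N : prime p -> (0 < N)%N ->
  \sum_(d <- divisors (p * N)) chi3 d + chi3 p *
    (if (p %| N)%N then \sum_(d <- divisors (N %/ p)) chi3 d else 0) =
  (1 + chi3 p) * \sum_(d <- divisors N) chi3 d.
Proof.
move=> pp N0; have p0 := prime_gt0 pp.
have pN0 : (0 < p * N)%N by rewrite muln_gt0 p0.
rewrite (bigID (fun d => p %| d)%N) /= (sum_divisors_mul _ pN0 p0) dvdn_mulr // mulKn
  //.
rewrite [X in _ = _ * X](bigID (fun d => p %| d)%N) /= (sum_divisors_mul _ N0 p0).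
have -> : \sum_(d <- divisors (p * N) | ~~ (p %| d)%N) chi3 d =
          \sum_(d <- divisors N | ~~ (p %| d)%N) chi3 d.
  apply: (big_bij (h := id) (h' := id)); rewrite ?divisors_uniq // => d;
    rewrite -!dvdn_divisors // => dN pd; split=> //.
    by rewrite -(@Gauss_dvdr d p) // coprime_sym prime_coprime.
  by rewrite dvdn_mull.
have E m : \sum_(d <- divisors m) chi3 (d * p) = chi3 p * \sum_(d <- divisors m) chi3 d.
  by rewrite mulr_sumr; apply: eq_bigr => d _; rewrite chi3M mulrC.
rewrite !E; have := sum_divisors_mul chi3 N0 p0; rewrite E => e.
rewrite [in X in chi3 p * X + _](bigID (fun d => p %| d)%N) /= e.
by case: ifP => _; ring.
Qed.

(** Both sides satisfy [r(p N) + chi3(p) r(N / p) = (1 + chi3(p)) r(N)], where [r(N / p)] is 0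
    unless [p] divides [N]: ramified, split and inert primes give the three values of [chi3(p)]. The
    factor 6 is the number of units. *)
Lemma normset_sum_chi3 N : (0 < N)%N ->
  (normset_num N)%:R = 6 * \sum_(d <- divisors N) chi3 d.
Proof.
elim/ltn_ind: N => N IH N0.
have [N1|N1] := leqP N 1.
  have -> : N = 1%N by lia.
  by rewrite normset1 (_ : divisors 1 = [:: 1%N]) // big_seq1.
have pp := pdiv_prime N1; set p := pdiv N in pp.
have p1 := prime_gt1 pp.
pose M := (N %/ p)%N.
have eN : N = (p * M)%N by rewrite mulnC divnK // pdiv_dvd.
have M0 : (0 < M)%N by nia.
have IHM := IH M _ M0.
have rec := sum_chi3_mul pp M0.
have IHMp : (p %| M)%N -> (normset_num (M %/ p))%:R = 6 * \sum_(d <- divisors (M %/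
  p)) chi3 d.
  move=> /divnK e; apply: IH; last by nia.
  nia.
rewrite eN; have ltM : (M < N)%N by nia.
have {}IHM := IHM ltM.
have := ltn_pmod p (isT : 0 < 3)%N; case e3 : (p %% 3)%N => [|[|[|]]] // _.
- have p3 : p = 3%N.
    by apply/eqP; rewrite eq_sym -(dvdn_prime2 _ pp) // /dvdn e3.
  move: rec; rewrite p3 normset_mul3 IHM (_ : chi3 3 = 0) // mul0r !addr0 mul1r => ->.
  by [].
- have := normset_split pp M e3 => /(congr1 (fun k => k%:R : rat)).
  have cp : chi3 p = 1 by rewrite /chi3 e3.
  move: rec; rewrite cp natrD natrM IHM.
  case: ifP => [/IHMp ->|_]; lra.
- have cp : chi3 p = -1 by rewrite /chi3 e3.
  rewrite (normset_inert pp) //; move: rec; rewrite cp.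
  case: ifP => [/IHMp ->|_]; lra.
Qed.

Lemma normset_num0 : normset_num 0 = 1%N.
Proof.
suff -> : normset 0 = [fset (0, 0)]%fset by rewrite cardfs1.
apply/fsetP => -[x y]; rewrite in_normset inE; apply/eqP/eqP => [e|[-> ->]] //.
have {}e : x ^+ 2 + y ^+ 2 + x * y = 0 := e.
by congr pair; nia.
Qed.

(** * Asymptotic expansions at the cusp *)

Section Asymptotics.
Variable R : realType.
Implicit Types (P Q : {poly R}) (phi psi : R -> R) (c d : fps rat).

Lemma horner_bounded P : exists2 B : R, 0 <= B &
  forall q, 0 <= q -> q <= 1 -> `|P.[q]| <= B.
Proof.
elim/poly_ind: P => [|P a [B B0 hB]]; first by exists 0 => // q _ _;
  rewrite horner0 normr0.
exists (B + `|a|) => [|q q0 q1]; first by rewrite addr_ge0.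
rewrite hornerMXaddC (le_trans (ler_normD _ _)) // lerD2r normrM (ger0_norm q0).
rewrite -[leRHS]mulr1; apply: ler_pM => //; exact: hB.
Qed.

(** The constant term is bounded by a multiple of [q], so it vanishes; then divide by [q]. *)
Lemma poly_small_coef N : forall P (C e : R), 0 < e ->
    (forall q, 0 < q -> q < e -> `|P.[q]| <= C * q ^+ N) ->
  forall i, (i < N)%N -> P`_i = 0.
Proof.
elim: N => // N IH P C e e0 hP.
have [Q [a eP]] : exists Q a, P = Q * 'X + a%:P.
  by elim/poly_ind: (P) => [|Q a _]; [exists 0, 0; rewrite mul0r add0r|exists Q, a].
have [B B0 hB] := horner_bounded Q.
have PE q : P.[q] = Q.[q] * q + a by rewrite eP hornerMXaddC.
have a0 : a = 0.
  apply/eqP; rewrite -normr_eq0; apply/eqP/le_anti/andP; split=> //.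
  apply/ler_addgt0Pl => eps eps0; rewrite addr0.
  pose K := `|C| + B + 1.
  have K0 : 0 < K by rewrite /K; have := normr_ge0 C; lra.
  pose q := Num.min (Num.min (e / 2) 1) (eps / K).
  have q0 : 0 < q by rewrite !lt_min ltr01 !divr_gt0.
  have [qe q1 qeps] : [/\ q < e, q <= 1 & q * K <= eps].
    rewrite /q; split.
    - by rewrite gt_min gt_min; apply/orP; left; apply/orP; left; lra.
    - by rewrite ge_min ge_min lexx orbT.
    - by rewrite -ler_pdivlMr // ge_min lexx orbT.
  have h := hP q q0 qe; have hb := hB q (ltW q0) q1.
  have -> : a = P.[q] - Q.[q] * q by rewrite PE; ring.
  apply: le_trans qeps; rewrite (le_trans (ler_normB _ _)) // normrM (gtr0_norm q0).
  have hN : C * q ^+ N.+1 <= `|C| * q.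
    rewrite exprSr mulrA ler_pM2r //.
    have qN1 : q ^+ N <= 1 by rewrite exprn_ile1 // ltW.
    have qN0 : 0 <= q ^+ N by rewrite exprn_ge0 // ltW.
    rewrite (le_trans (ler_norm _)) // normrM (ger0_norm qN0).
    by rewrite -[leRHS]mulr1 ler_wpM2l.
  rewrite /K !mulrDr mulr1 [q * B]mulrC [q * `|C|]mulrC.
  have : `|Q.[q]| * q <= B * q by rewrite ler_pM2r.
  lra.
have hQ q : 0 < q -> q < e -> `|Q.[q]| <= C * q ^+ N.
  move=> q0 qe; have := hP q q0 qe; rewrite PE a0 addr0 normrM (gtr0_norm q0).
  by rewrite exprSr mulrA ler_pM2r.
have {}IH := IH Q C e e0 hQ.
by case=> [|i] iN; rewrite eP a0 addr0 coefMX //= IH.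
Qed.

(* [phi q = \sum_(m < N) c_m q ^ m + O(q ^ N)] as [q] tends to [0+] *)
Definition asymp (N : nat) c phi : Prop :=
  exists2 P : {poly R}, (forall i, (i < N)%N -> P`_i = ratr (fcoef c i)) &
    exists C e : R, [/\ 0 <= C, 0 < e, e <= 1 &
      forall q, 0 < q -> q < e -> `|phi q - P.[q]| <= C * q ^+ N].

Lemma asymp_weaken N c phi : asymp N.+1 c phi -> asymp N c phi.
Proof.
move=> [P cP [C [e [C0 e0 e1 hP]]]]; exists P; first by move=> i /ltnW; exact: cP.
exists C, e; split=> // q q0 qe; apply: le_trans (hP q q0 qe) _.
rewrite ler_wpM2l // exprS ler_piMl ?exprn_ge0 ?(ltW q0) //.
by rewrite (le_trans _ e1) // ltW.
Qed.

Lemma asymp_unique N c d phi psi (e : R) : asymp N c phi -> asymp N d psi ->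
    0 < e -> (forall q, 0 < q -> q < e -> phi q = psi q) ->
  forall i, (i < N)%N -> fcoef c i = fcoef d i.
Proof.
move=> [P cP [C [e1 [C0 e10 _ hP]]]] [Q dQ [D [e2 [D0 e20 _ hQ]]]] e0 E i iN.
suff : P`_i = Q`_i by rewrite cP ?dQ // => /fmorph_inj.
apply/eqP; rewrite -subr_eq0 -coefB; apply/eqP.
pose e' := Num.min e (Num.min e1 e2).
apply: (@poly_small_coef N (P - Q) (C + D) e') => //.
  by rewrite /e' !lt_min e0 e10 e20.
move=> q q0; rewrite /e' !lt_min => /and3P[qe qe1 qe2].
rewrite hornerD hornerN mulrDl.
have -> : P.[q] - Q.[q] = (psi q - Q.[q]) - (phi q - P.[q]) by rewrite E //; ring.
by rewrite (le_trans (ler_normB _ _)) // addrC lerD ?hP ?hQ.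
Qed.

Lemma asymp_bounded N c phi : asymp N c phi -> exists B e : R,
  [/\ 0 <= B, 0 < e, e <= 1 & forall q, 0 < q -> q < e -> `|phi q| <= B].
Proof.
move=> [P _ [C [e [C0 e0 e1 hP]]]]; have [B B0 hB] := horner_bounded P.
exists (C + B), e; split=> //; first exact: addr_ge0.
move=> q q0 qe; have q1 : q <= 1 by rewrite (le_trans _ e1) // ltW.
have -> : phi q = (phi q - P.[q]) + P.[q] by ring.
rewrite (le_trans (ler_normD _ _)) // lerD ?hB ?(ltW q0) //.
rewrite (le_trans (hP _ q0 qe)) // -[leRHS]mulr1 ler_wpM2l //.
by rewrite exprn_ile1 // ltW.
Qed.

Lemma asympM N c d phi psi : asymp N c phi -> asymp N d psi ->
  asymp N (c * d) (fun q => phi q * psi q).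
Proof.
move=> hphi hpsi; have [B [e3 [B0 e30 e31 hB]]] := asymp_bounded hphi.
case: hphi hpsi => [P cP [C [e1 [C0 e10 e11 hP]]]] [Q dQ [D [e2 [D0 e20 _ hQ]]]].
have [B' B'0 hB'] := horner_bounded Q.
exists (P * Q).
  move=> i iN; rewrite coefM fcoefM rmorph_sum; apply: eq_bigr => -[j /= ji] _.
  by rewrite rmorphM /=; congr (_ * _); [apply: cP|apply: dQ]; lia.
exists (B * D + C * B'), (Num.min e3 (Num.min e1 e2)); split.
- by rewrite addr_ge0 // mulr_ge0.
- by rewrite !lt_min e30 e10 e20.
- by rewrite ge_min e31.
move=> q q0; rewrite !lt_min => /and3P[qe3 qe1 qe2].
have q1 : q <= 1 by rewrite (le_trans _ e31) // ltW.
rewrite hornerM.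
have -> : phi q * psi q - P.[q] * Q.[q] =
  phi q * (psi q - Q.[q]) + (phi q - P.[q]) * Q.[q] by ring.
have qN : 0 <= q ^+ N by rewrite exprn_ge0 // ltW.
rewrite (le_trans (ler_normD _ _)) // !normrM mulrDl lerD //.
  by rewrite -mulrA ler_pM ?hB ?hQ.
by rewrite mulrAC ler_pM ?hP ?hB' // ltW.
Qed.

Lemma asympD N c d phi psi : asymp N c phi -> asymp N d psi ->
  asymp N (c + d) (fun q => phi q + psi q).
Proof.
move=> [P cP [C [e1 [C0 e10 e11 hP]]]] [Q dQ [D [e2 [D0 e20 _ hQ]]]].
exists (P + Q).
  by move=> i iN; rewrite coefD fcoefD rmorphD /= cP ?dQ.
exists (C + D), (Num.min e1 e2); split.
- by rewrite addr_ge0.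
- by rewrite !lt_min e10 e20.
- by rewrite ge_min e11.
move=> q q0; rewrite !lt_min => /andP[qe1 qe2].
have -> : phi q + psi q - (P + Q).[q] = (phi q - P.[q]) + (psi q - Q.[q]).
  by rewrite hornerD; ring.
by rewrite (le_trans (ler_normD _ _)) // mulrDl lerD ?hP ?hQ.
Qed.

Lemma asympC N (r : rat) : asymp N (fpsC r) (fun=> ratr r).
Proof.
exists (ratr r)%:P.
  by move=> [|i] _; rewrite coefC /fcoef //= rmorph0.
exists 0, 1; split=> // q _ _.
by rewrite hornerC subrr normr0 mul0r.
Qed.

Lemma asympZ N r c phi : asymp N c phi ->
  asymp N (fpsC r * c) (fun q => ratr r * phi q).
Proof. exact: asympM (asympC N r). Qed.

Lemma asympN N c phi : asymp N c phi -> asymp N (- c) (fun q => - phi q).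
Proof.
move=> [P cP [C [e [C0 e0 e1 hP]]]]; exists (- P).
  by move=> i iN; rewrite coefN fcoefN rmorphN /= cP.
exists C, e; split=> // q q0 qe.
by rewrite hornerN -opprD normrN hP.
Qed.

Lemma asympX N c phi k : asymp N c phi -> asymp N (c ^+ k) (fun q => phi q ^+ k).
Proof.
move=> h; elim: k => [|k IH].
  have := asympC N 1; rewrite rmorph1.
  have -> : fpsC (1 : rat) = 1 by apply: fpsP => -[|i]; rewrite fcoef1.
  by [].
by rewrite exprS; under eq_fun do rewrite exprS; exact: asympM.
Qed.

Lemma asymp_sum N (I : Type) (r : seq I) (c : I -> fps rat) (phi : I -> R -> R) :
    (forall i, asymp N (c i) (phi i)) ->
  asymp N (\sum_(i <- r) c i) (fun q => \sum_(i <- r) phi i q).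
Proof.
move=> h; elim: r => [|i r IH].
  rewrite big_nil; under eq_fun do rewrite big_nil.
  have := asympC N 0; rewrite rmorph0.
  by have -> : fpsC (0 : rat) = 0 by apply: fpsP => -[|j].
rewrite big_cons.
have -> : (fun q => \sum_(j <- i :: r) phi j q) =
          (fun q => phi i q + \sum_(j <- r) phi j q).
  by apply/funext => q; rewrite big_cons.
exact: asympD.
Qed.

(** Applied to [E4], [E6] and [Delta], this makes the denominator in the definition of [P] nonzero
    near the cusp. *)
Lemma asymp_gt0 N c phi i : asymp N c phi -> (i < N)%N ->
    (forall j, (j < i)%N -> fcoef c j = 0) -> fcoef c i = 1 ->
  exists2 e : R, 0 < e & forall q, 0 < q -> q < e -> 0 < phi q.
Proof.
move=> [P cP [C [e [C0 e0 e1 hP]]]] iN c0 ci.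
pose U := drop_poly i.+1 P.
have eP : P = 'X^i + U * 'X^(i.+1).
  rewrite -[LHS](poly_take_drop i.+1); congr (_ + _); apply/polyP => j.
  rewrite coef_take_poly coefXn; have [ji|ij|->] := ltngtP j i.
  - by rewrite ltnS (ltnW ji) cP ?(ltn_trans ji) // c0 // rmorph0.
  - by rewrite ltnS leqNgt ij.
  - by rewrite ltnS leqnn cP // ci rmorph1.
have [B B0 hB] := horner_bounded U.
(* [B] bounds the tail of the polynomial and [C] the error term; the 1 keeps [K] positive. *)
pose K := B + C + 1; have K0 : 0 < K by rewrite /K; lra.
exists (Num.min e K^-1) => [|q q0]; first by rewrite lt_min e0 invr_gt0.
rewrite lt_min => /andP[qe qK].
have q1 : q <= 1 by rewrite (le_trans _ e1) // ltW.
have h := hP q q0 qe; have hU := hB q (ltW q0) q1.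
have eqP' : P.[q] = q ^+ i + U.[q] * q ^+ i.+1.
  by rewrite eP hornerD hornerM !hornerXn.
have qi0 : 0 < q ^+ i by rewrite exprn_gt0.
have hN : C * q ^+ N <= C * q ^+ i.+1.
  rewrite ler_wpM2l // -(subnKC iN) exprD -[leRHS]mulr1 ler_wpM2l ?exprn_ge0 ?(ltW
    q0) //.
  by rewrite exprn_ile1 // ltW.
have hU' : - (B * q ^+ i.+1) <= U.[q] * q ^+ i.+1.
  rewrite -mulNr ler_wpM2r ?exprn_ge0 ?(ltW q0) //.
  by move: hU; rewrite ler_norml => /andP[].
have hq : q * K < 1 by rewrite -ltr_pdivlMr // div1r.
have : q ^+ i * (1 - q * K) > 0 by rewrite mulr_gt0 // subr_gt0.
have eK : q ^+ i * (1 - q * K) = q ^+ i - B * q ^+ i.+1 - C * q ^+ i.+1 - q ^+ i.+1.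
  by rewrite /K exprS; ring.
have qi1 : 0 < q ^+ i.+1 by rewrite exprn_gt0.
move: h; rewrite ler_norml => /andP[h _].
rewrite eK; rewrite eqP' in h; lra.
Qed.

End Asymptotics.

(** * Convergent power series in a real variable *)

Section QSeries.
Local Open Scope classical_set_scope.
Variable R : realType.
Implicit Types (c : nat -> rat) (phi : R -> R).

Definition rterm c (q : R) (n : nat) : R := ratr (c n) * q ^+ n.

Definition exp_growth c (C K : R) : Prop :=
  [/\ 0 <= C, 0 < K & forall m, `|ratr (c m) : R| <= C * K ^+ m].

(** A geometric series in telescoping form: [x^m <= 2 x^m - 2 x^(m+1)] for [0 <= x <= 1/2]. *)
Lemma rterm_tail c C K (q : R) N M : exp_growth c C K ->
    0 < q -> K * q <= 1 / 2 -> (N <= M)%N ->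
  \sum_(N <= m < M) `|rterm c q m| <= 2 * C * (K * q) ^+ N.
Proof.
move=> [C0 K0 hc] q0 Kq NM; set x := K * q in Kq *.
have x0 : 0 < x by rewrite mulr_gt0.
apply: (@le_trans _ _ (\sum_(N <= m < M) (2 * C * x ^+ m - 2 * C * x ^+ m.+1))).
  apply: ler_sum_nat => m _; rewrite /rterm normrM (ger0_norm (exprn_ge0 _ (ltW q0))).
  have -> : 2 * C * x ^+ m - 2 * C * x ^+ m.+1 = C * K ^+ m * q ^+ m * (2 * (1 - x)).
    by rewrite exprS /x exprMn; ring.
  have h : `|ratr (c m) : R| * q ^+ m <= C * K ^+ m * q ^+ m.
    by rewrite ler_wpM2r ?exprn_ge0 ?(ltW q0).
  apply: le_trans h _; rewrite -[leLHS]mulr1 ler_wpM2l //; last lra.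
  by rewrite !mulr_ge0 // exprn_ge0 // ltW.
rewrite (@telescope_sumr_eq _ N M (fun m => - (2 * C * x ^+ m))) //; last first.
  by move=> m _; ring.
have : 0 <= 2 * C * x ^+ M by rewrite !mulr_ge0 // exprn_ge0 // ltW.
lra.
Qed.

Lemma cvg_rterm c C K (q : R) : exp_growth c C K -> 0 < q -> K * q <= 1 / 2 ->
  cvgn (series (rterm c q)).
Proof.
move=> hc q0 Kq; apply: normed_cvg; apply: nondecreasing_is_cvgn.
  by apply: nondecreasing_series => n _; rewrite normr_ge0.
exists (2 * C * (K * q) ^+ 0) => _ [n _ <-].
by rewrite /series /=; exact: rterm_tail.
Qed.

Lemma rterm_approx c C K (q : R) N (s : R) : exp_growth c C K ->
    0 < q -> K * q <= 1 / 2 -> series (rterm c q) @ \oo --> s ->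
  `|s - \sum_(0 <= m < N) rterm c q m| <= 2 * C * (K * q) ^+ N.
Proof.
move=> hc q0 Kq hs.
have h : (fun M => `|series (rterm c q) M - \sum_(0 <= m < N) rterm c q m|) @ \oo -->
    `|s - \sum_(0 <= m < N) rterm c q m|.
  by apply: cvg_norm; apply: cvgB => //; exact: cvg_cst.
apply: (ler_cvg_to h (@cvg_cst _ _ _ _ _)).
exists N => // M /= NM;
  rewrite /series /= (big_cat_nat _ (n := N)) //= addrAC subrr add0r.
by rewrite (le_trans (ler_norm_sum _ _ _)) //; exact: rterm_tail.
Qed.

Lemma asymp_series c C K phi (e : R) N : exp_growth c C K -> 0 < e ->
    (forall q, 0 < q -> q < e -> series (rterm c q) @ \oo --> phi q) ->
  asymp N (Fps c) phi.
Proof.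
move=> hc e0 hphi; have [C0 K0 _] := hc.
exists (\poly_(m < N) ratr (c m)).
  by move=> i iN; rewrite coef_poly iN.
exists (2 * C * K ^+ N), (Num.min 1 (Num.min e (1 / (2 * K)))); split.
- by rewrite !mulr_ge0 // exprn_ge0 // ltW.
- by rewrite !lt_min ltr01 e0 divr_gt0 // mulr_gt0.
- by rewrite ge_min lexx.
move=> q q0; rewrite !lt_min => /and3P[_ qe qK].
have Kq : K * q <= 1 / 2.
  by move: qK; rewrite ltr_pdivlMr ?mulr_gt0 //; lra.
have -> : (\poly_(m < N) ratr (c m)).[q] = \sum_(0 <= m < N) rterm c q m.
  by rewrite horner_poly big_mkord.
have -> : 2 * C * K ^+ N * q ^+ N = 2 * C * (K * q) ^+ N by rewrite exprMn; ring.
exact: (rterm_approx N hc q0 Kq (hphi q q0 qe)).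
Qed.

(** The terms of a convergent series are bounded. This supplies the growth of the coefficients of
    the given form, known only through the convergence of its expansion. *)
Lemma exp_growth_of_cvg c (q : R) : 0 < q -> cvgn (series (rterm c q)) ->
  exists C K, exp_growth c C K.
Proof.
move=> q0 hc.
have [M [Mr hM]] := cvg_series_bounded hc.
exists (`|M| + 1), q^-1; split; [by rewrite addr_ge0|by rewrite invr_gt0|].
move=> m; have := hM (`|M| + 1);
  rewrite /= (le_lt_trans (ler_norm M)) ?ltrDl // => /(_ isT m I).
rewrite /rterm normrM (ger0_norm (exprn_ge0 _ (ltW q0))) exprVn.
by rewrite ler_pdivlMr // exprn_gt0.
Qed.

Lemma qpar_imag (y : R) : qpar (0 +i* y) = (expR (- (2 * pi * y)))%:C.
Proof. by rewrite /qpar /= mulr0 cos0 sin0 mulr1. Qed.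

Lemma ratr_complex (r : rat) : ratr r = (ratr r : R)%:C :> R[i].
Proof. by rewrite -(fmorph_eq_rat (real_complex R \o @ratr R)). Qed.

Lemma series_qterm c (y : R) n :
  series (qterm c (0 +i* y)) n = (series (rterm c (expR (- (2 * pi * y)))) n)%:C.
Proof.
rewrite /series /= rmorph_sum /=; apply: eq_bigr => m _.
by rewrite /qterm qpar_imag /rterm rmorphM rmorphXn /= ratr_complex.
Qed.

Lemma cvg_real_complex (u : nat -> R) (s : R) : u @ \oo --> s ->
  (fun n => (u n)%:C : R[i]^o) @ \oo --> (s%:C : R[i]^o).
Proof.
move=> /cvgrPdist_lt hu; apply/cvgrPdist_lt => -[e e'] /=.
rewrite ltcE /= => /andP[/eqP -> e0].
have := hu e e0; apply: filterS => n.
by rewrite -rmorphB /= normc_def /= expr0n addr0 sqrtr_sqr ltcE /= eqxx.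
Qed.

Lemma cvg_complex_real (u : nat -> R) (z : R[i]) :
  (fun n => (u n)%:C : R[i]^o) @ \oo --> (z : R[i]^o) -> u @ \oo --> complex.Re z.
Proof.
move=> /cvgrPdist_lt hu; apply/cvgrPdist_lt => e e0.
have e0' : 0 < e%:C :> R[i] by rewrite ltcE /= eqxx.
have := hu _ e0'; apply: filterS => n.
case: z {hu} => a b /=; rewrite normc_def /= ltcE /= => /andP[_].
apply: le_lt_trans; rewrite -sqrtr_sqr ler_wsqrtr // lerDl sqr_ge0 //.
Qed.

End QSeries.

(** * Identification with the given Eisenstein and theta series *)

Lemma bernoulli_num46 : bernoulli_num 4 = - (1 / 30) /\ bernoulli_num 6 = 1 / 42.
Proof.
have S m s : bernoulli_seq m = s -> bernoulli_seq m.+1 =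
    rcons s (- (m.+2%:R)^-1 * \sum_(i < m.+1) 'C(m.+2, i)%:R * s`_i) by move=> <-.
have b0 : bernoulli_seq 0 = [:: 1] by [].
have b1 : bernoulli_seq 1 = [:: 1; - (1 / 2)].
  by rewrite (S _ _ b0) !big_ord_recr big_ord0 /=; congr [:: _; _]; field.
have b2 : bernoulli_seq 2 = [:: 1; - (1 / 2); 1 / 6].
  by rewrite (S _ _ b1) !big_ord_recr big_ord0 /=; congr [:: _; _; _]; field.
have b3 : bernoulli_seq 3 = [:: 1; - (1 / 2); 1 / 6; 0].
  by rewrite (S _ _ b2) !big_ord_recr big_ord0 /=; congr [:: _; _; _; _]; field.
have b4 : bernoulli_seq 4 = [:: 1; - (1 / 2); 1 / 6; 0; - (1 / 30)].
  by rewrite (S _ _ b3) !big_ord_recr big_ord0 /=; congr [:: _; _; _; _; _]; field.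
have b5 : bernoulli_seq 5 = [:: 1; - (1 / 2); 1 / 6; 0; - (1 / 30); 0].
  by rewrite (S _ _ b4) !big_ord_recr big_ord0 /=; congr [:: _; _; _; _; _; _]; field.
have b6 : bernoulli_seq 6 = [:: 1; - (1 / 2); 1 / 6; 0; - (1 / 30); 0; 1 / 42].
  by rewrite (S _ _ b5) !big_ord_recr big_ord0 /=; congr [:: _; _; _; _; _; _; _];
    field.
by split; rewrite /bernoulli_num ?b4 ?b6; exact: erefl.
Qed.

Lemma natr_sum_exp (s : seq nat) k :
  (\sum_(d <- s) d ^ k)%N%:R = \sum_(d <- s) d%:R ^+ k :> rat.
Proof. by rewrite natr_sum; apply: eq_bigr => d _; rewrite natrX. Qed.

Lemma eis_coef4 : Fps (eis_coef 4) = E4.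
Proof.
apply: fpsP => n; rewrite {1}/fcoef /eis_coef; have [->|n0] := eqVneq n 0%N.
  by rewrite E4_0.
have [b4 _] := bernoulli_num46; have n_gt0 : (0 < n)%N by rewrite lt0n.
rewrite (E4_fcoef n_gt0) b4 natr_sum_exp.
have -> : (2 * 4)%:R / - (1 / 30) = - 240 :> rat by field.
by rewrite opprK.
Qed.

Lemma eis_coef6 : Fps (eis_coef 6) = E6.
Proof.
apply: fpsP => n; rewrite {1}/fcoef /eis_coef; have [->|n0] := eqVneq n 0%N.
  by rewrite E6_0.
have [_ b6] := bernoulli_num46; have n_gt0 : (0 < n)%N by rewrite lt0n.
rewrite (E6_fcoef n_gt0) b6 natr_sum_exp.
have -> : (2 * 6)%:R / (1 / 42) = 504 :> rat by field.
exact: mulNr.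
Qed.

Lemma thetaH_theta n : fcoef theta n = thetaH n.
Proof.
have -> : thetaH n = (#|` normset n|)%:R.
  rewrite /thetaH; congr (#|` _|%:R).
  have e : [set x : int * int | x.1 ^+ 2 + x.2 ^+ 2 + x.1 * x.2 = n%:Z]%classic =
      [set` normset n]%classic.
    apply/seteqP; split=> x /=; first by move=> h; rewrite in_normset; apply/eqP.
    by rewrite in_normset => /eqP.
  by rewrite e set_fsetK.
have [->|n0] := posnP n; first by rewrite theta_0 normset_num0.
by rewrite theta_fcoef // normset_sum_chi3.
Qed.

(** At most [m] divisors, none above [m], give [m^(k+1)]; an exponential bound in [m] is all that
    convergence needs. *)
Lemma sigma_nat_le m k : (\sum_(d <- divisors m) d ^ k <= (2 ^ k.+1) ^ m)%N.
Proof.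
have [->|m0] := posnP m; first by rewrite (_ : divisors 0 = [:: 1%N]) // big_seq1 exp1n.
apply: (@leq_trans (m ^ k.+1));
  last by rewrite -expnM mulnC expnM leq_exp2r // ltnW // ltn_expl.
apply: (@leq_trans (\sum_(d <- divisors m) m ^ k)).
  rewrite big_seq [leqRHS]big_seq; apply: leq_sum => d; rewrite -dvdn_divisors // => dm.
  by case: k => // k; rewrite leq_exp2r // dvdn_leq.
rewrite big_const_seq count_predT iter_addn_0 expnSr leq_mul2l; apply/orP; right.
rewrite -{2}(size_iota 1 m); apply: uniq_leq_size; first exact: divisors_uniq.
by move=> d; rewrite -dvdn_divisors // mem_iota => dm; have := dvdn_leq m0 dm;
  have := dvdn_gt0 m0 dm; lia.
Qed.

Section Growth.
Local Open Scope classical_set_scope.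
Variable R : realType.

Lemma exp_growth_eis k : (0 < k)%N -> exists C K : R, exp_growth (eis_coef k) C K.
Proof.
move=> k0; pose A : rat := (2 * k)%:R / bernoulli_num k.
exists (ratr (1 + `|A|)), ((2 ^ k)%:R); split.
- by rewrite ler0q addr_ge0.
- by rewrite ltr0n expn_gt0.
move=> m; rewrite -ratr_nat -ratr_norm -rmorphXn -rmorphM ler_rat.
rewrite /eis_coef; case: eqP => [->|_].
  by rewrite expr0 mulr1 normr1 lerDl.
rewrite -/A normrM normrN -natrX normr_nat.
apply: ler_pM => //; first by rewrite lerDr.
by rewrite ler_nat; have := sigma_nat_le m k.-1; rewrite prednK.
Qed.

Lemma qsum_asymp c C K N : @exp_growth R c C K ->
  exists (phi : R -> R) (e : R), [/\ asymp N (Fps c) phi, 0 < e &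
    forall y, expR (- (2 * pi * y)) < e ->
      qsum c (0 +i* y) = (phi (expR (- (2 * pi * y))))%:C].
Proof.
move=> hc; have [C0 K0 _] := hc.
exists (fun q => limn (series (rterm c q))), (1 / (2 * K)).
have e0 : 0 < 1 / (2 * K) by rewrite divr_gt0 // mulr_gt0.
have hK q : 0 < q -> q < 1 / (2 * K) -> cvgn (series (@rterm R c q)).
  move=> q0 qK; apply: (cvg_rterm hc q0).
  by move: qK; rewrite ltr_pdivlMr ?mulr_gt0 //; lra.
split=> //.
  by apply: (asymp_series N hc e0) => q q0 qe; apply: hK.
move=> y ye; have hy := hK _ (expR_gt0 _) ye.
rewrite /qsum; apply: (@cvg_lim R[i]^o); first exact: norm_hausdorff.
have -> : series (qterm c (0 +i* y)) =
    (fun n => (series (rterm c (expR (- (2 * pi * y)))) n)%:C) :> (nat -> R[i]^o).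
  by apply/funext => n; rewrite series_qterm.
exact: cvg_real_complex.
Qed.

End Growth.

(** * Coefficients of the hypergeometric series *)

Section Hypergeometric.
Variables (x y w : rat).
Hypothesis w_gt0 : 0 < w.

Lemma risingS a m : rising a m.+1 = rising a m * (a + m%:R).
Proof. exact: big_ord_recr. Qed.

Lemma rising_gt0 m : 0 < rising w m.
Proof.
by apply: prodr_gt0 => i _; apply: ltr_wpDr => //; rewrite ler0n.
Qed.

Lemma hyp2F1_coefS m : (w + m%:R) * m.+1%:R * hyp2F1_coef x y w m.+1 =
  (x + m%:R) * (y + m%:R) * hyp2F1_coef x y w m.
Proof.
have r0 : rising w m != 0 by rewrite gt_eqF // rising_gt0.
have w0 : w + m%:R != 0 by rewrite gt_eqF // ltr_wpDr // ler0n.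
have f0 : m`!%:R != 0 :> rat by rewrite pnatr_eq0 -lt0n fact_gt0.
have m0 : m.+1%:R != 0 :> rat by rewrite pnatr_eq0.
rewrite /hyp2F1_coef !risingS factS natrM.
move: r0 w0 f0 m0; move: (rising w m) (m`!%:R) (w + m%:R) (m.+1%:R) => u v s t *.
by field; apply/and4P.
Qed.

End Hypergeometric.

Definition hyp_coef (b : bool) (m : nat) : rat :=
  if b then hyp2F1_coef (5%:R / 12%:R) (3%:R / 4%:R) (2%:R / 3%:R) m
  else hyp2F1_coef (- (1 / 12%:R)) (1 / 4%:R) (2%:R / 3%:R) m.

Lemma coef_V b n i :
  (V b n)`_i = if (i < n.+1)%N then hyp_coef b (n - i) * 1728%:R ^+ (n - i) else 0.
Proof. by rewrite /V /hyp_coef; case: b; rewrite coef_poly. Qed.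

Lemma hyp_coef0 b : hyp_coef b 0 = 1.
Proof.
by case: b; rewrite /hyp_coef /hyp2F1_coef /rising !big_ord0 fact0 !divr1 ?mulr1.
Qed.

(** Gauss' recursion multiplied by 144. Euler's transformation preserves the third parameter, hence
    [alpha] is common to both values of [b]. *)
Lemma hyp_coef_rec b m : alpha m.+1 * hyp_coef b m.+1 = beta b m * hyp_coef b m.
Proof.
have w0 : 0 < 2%:R / 3%:R :> rat by [].
have h0 := hyp2F1_coefS (- (1 / 12%:R)) (1 / 4%:R) w0 m.
have h1 := hyp2F1_coefS (5%:R / 12%:R) (3%:R / 4%:R) w0 m.
rewrite /hyp_coef /alpha /beta; case: b; [move: h1 {h0}|move: h0 {h1}];
  cbv iota; rewrite -[m.+1%:R]natr1;
    move: (hyp2F1_coef _ _ _ m) (hyp2F1_coef _ _ _ m.+1) (m%:R) => u v s h;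
  by apply: (eq_by_sub (congr1 (fun z => 144 * z) h)); field.
Qed.

Lemma hyp_coef_exp_rec b m (z : rat) :
  alpha m.+1 * (hyp_coef b m.+1 * z ^+ m.+1) = z * beta b m * (hyp_coef b m * z ^+ m).
Proof. by rewrite mulrA hyp_coef_rec exprS; ring. Qed.

(** * Eisenstein series and [Delta] on the imaginary axis *)

Section ImaginaryAxis.
Local Open Scope classical_set_scope.
Variable R : realType.

Definition qexpansion (N : nat) (g : R[i] -> R[i]) (c : fps rat) : Prop :=
  exists (phi : R -> R) (e : R), [/\ asymp N c phi, 0 < e &
    forall y, expR (- (2 * pi * y)) < e -> g (0 +i* y) = (phi (expR (- (2 * pi *
      y))))%:C].

Lemma qexpansion_E4 N : qexpansion N (@Eis R 4) E4.
Proof.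
have [C [K hc]] := @exp_growth_eis R 4 isT.
by have := qsum_asymp N hc; rewrite eis_coef4.
Qed.

Lemma qexpansion_E6 N : qexpansion N (@Eis R 6) E6.
Proof.
have [C [K hc]] := @exp_growth_eis R 6 isT.
by have := qsum_asymp N hc; rewrite eis_coef6.
Qed.

Lemma qexpansion_Delta N : qexpansion N (@Delta R) DeltaF.
Proof.
have [e4 [r4 [as4 r40 E4q]]] := qexpansion_E4 N.
have [e6 [r6 [as6 r60 E6q]]] := qexpansion_E6 N.
exists (fun q => ratr 1728%:R^-1 * (e4 q * e4 q * e4 q - e6 q * e6 q)), (Num.min r4 r6).
split; last 1 first.
- move=> y; rewrite lt_min => /andP[h4 h6]; rewrite /Delta E4q // E6q //.
  have -> : ratr 1728%:R^-1 = 1728%:R^-1 :> R by rewrite fmorphV rmorph_nat.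
  move: (e4 _) (e6 _) => u v; rewrite mulrC rmorphM fmorphV rmorph_nat.
  by congr (_ * _); rewrite rmorphB !rmorphM /= -!expr2 -exprSr.
- apply: asympZ; apply: asympD; first by do 2!apply: asympM => //.
  by apply: asympN; apply: asympM.
- by rewrite lt_min r40.
Qed.

End ImaginaryAxis.

Section Main.
Local Open Scope classical_set_scope.
Variable R : realType.

(* On the imaginary axis all series are real, and [f = Delta^n E6^b P(j)] is an
   identity of real functions of [q], to be compared with [f = theta + O(q^(n+1))]. *)
Lemma theta_P_coef (k n : nat) (a : 'I_3) (b : bool) (f : R[i] -> R[i])
    (P : {poly rat}) : a = 0 :> nat ->
    is_Ck k n thetaH f -> is_P_of n a b f P ->
  forall i, (i <= n)%N ->
    fcoef theta i = fcoef (\sum_(m < n.+1) fpsC P`_(n - m) * Xm n b m) i.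
Proof.
move=> a0 [c [_ cf] cth] [sP hP] i iN.
rewrite thetaH_theta -cth //.
(* The height on the imaginary axis at which the parameter is [q]. *)
pose y (q : R) := - ln q / (2 * pi).
have pi2 : 2 * pi != 0 :> R by rewrite gt_eqF // mulr_gt0 // pi_gt0.
have yq q : 0 < q -> expR (- (2 * pi * y q)) = q.
  by move=> q0; rewrite /y mulrC divfK // opprK lnK.
have y0 q : 0 < q -> q < 1 -> 0 < y q.
  move=> q0 q1; rewrite /y divr_gt0 ?mulr_gt0 ?pi_gt0 // oppr_gt0.
  by rewrite ln_lt0 // q0.
have cvf q : 0 < q -> q < 1 ->
    series (rterm c q) @ \oo --> complex.Re (f (0 +i* y q)).
  move=> q0 q1; apply: cvg_complex_real.
  have := cf (0 +i* y q) (y0 q q0 q1).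
  have -> // : series (qterm c (0 +i* y q)) =
    (fun n => (series (rterm c q) n)%:C) :> (nat -> R[i]^o).
  by apply/funext => l; rewrite series_qterm yq.
have [C [K hc]] : exists C K : R, exp_growth c C K.
  have h0 : 0 < 1 / 2 :> R by lra.
  have h1 : 1 / 2 < 1 :> R by lra.
  by apply: (exp_growth_of_cvg h0); apply/cvg_ex; eexists; exact: cvf h0 h1.
have asf : asymp n.+1 (Fps c) (fun q => complex.Re (f (0 +i* y q))).
  exact: (asymp_series n.+1 hc ltr01 cvf).
(* One order more than the comparison needs, so that the leading term [q] of [Delta] is visible even
   for [n = 0]. *)
have [e4 [r4 [as4 r40 E4q]]] := qexpansion_E4 R n.+2.
have [e6 [r6 [as6 r60 E6q]]] := qexpansion_E6 R n.+2.
have [dl [rD [asD rD0 Dq]]] := qexpansion_Delta R n.+2.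
have [s4 s40 e4_gt0] := asymp_gt0 as4 (ltn0Sn _) (fun j (h : (j < 0)%N) => False_ind
  _ (notF h)) E4_0.
have [s6 s60 e6_gt0] := asymp_gt0 as6 (ltn0Sn _) (fun j (h : (j < 0)%N) => False_ind
  _ (notF h)) E6_0.
have D0 j : (j < 1)%N -> fcoef DeltaF j = 0 by case: j => // _; exact: DeltaF_0.
have [sD sD0 dl_gt0] := asymp_gt0 asD (isT : (1 < n.+2)%N) D0 DeltaF_1.
pose psi q : R := \sum_(m < n.+1) ratr P`_(n - m) *
  (e6 q ^+ b * (e4 q ^+ (3 * (n - m)) * dl q ^+ m)).
have asPsi : asymp n.+2 (\sum_(m < n.+1) fpsC P`_(n - m) * Xm n b m) psi.
  apply: asymp_sum => m; apply: asympZ; apply: asympM; first exact: asympX.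
  by apply: asympM; exact: asympX.
pose e := Num.min 1 (Num.min (Num.min (Num.min r4 r6) rD) (Num.min (Num.min s4 s6) sD)).
have e0 : 0 < e by rewrite /e !lt_min ltr01 r40 r60 rD0 s40 s60 sD0.
apply: (@asymp_unique _ n.+1 (Fps c) _ _ psi e asf) => //.
  exact: asymp_weaken.
move=> q q0; rewrite /e !lt_min => /and3P[q1 /andP[/andP[qr4 qr6] qrD]
  /andP[/andP[qs4 qs6] qsD]].
pose tau : R[i] := 0 +i* y q.
have Et4 : Eis 4 tau = (e4 q)%:C by rewrite /tau E4q yq.
have Et6 : Eis 6 tau = (e6 q)%:C by rewrite /tau E6q yq.
have EtD : Delta tau = (dl q)%:C by rewrite /tau Dq yq.
have d0 : (dl q)%:C != 0 :> R[i] by rewrite (fmorph_eq0 (real_complex R)) gt_eqF //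
  dl_gt0.
have := hP tau (y0 q q0 q1); rewrite /= Et4 Et6 EtD a0 expr0 mulr1.
have Dn0 : (dl q)%:C ^+ n * (e6 q)%:C ^+ b != 0 :> R[i].
  rewrite mulf_neq0 ?expf_neq0 // (fmorph_eq0 (real_complex R)) gt_eqF //.
  exact: e6_gt0.
move=> /(_ Dn0) /(canRL (divfK Dn0)); rewrite -/tau => ->.
have jE : jinv tau = (e4 q ^+ 3 / dl q)%:C.
  by rewrite /jinv Et4 EtD rmorphM fmorphV rmorphXn.
have PE : (map_poly ratr P).[jinv tau] =
    (\sum_(m < n.+1) ratr P`_m * (e4 q ^+ 3 / dl q) ^+ m)%:C.
  rewrite jE (@horner_coef_wide _ n.+1); last by rewrite size_map_poly.
  rewrite rmorph_sum; apply: eq_bigr => m _.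
  by rewrite coef_map /= ratr_complex -rmorphXn -rmorphM.
rewrite PE -!rmorphXn -!rmorphM /=.
(* Since [Delta^n j^(n-m) = E4^(3(n-m)) Delta^m], the coefficient of [j^(n-m)] in [P] goes with
   [Xm m]. *)
rewrite /psi mulr_suml (reindex_inj rev_ord_inj) /=; apply: eq_bigr => -[m /= mn] _.
rewrite subSS.
have d0' : dl q != 0 by rewrite gt_eqF // dl_gt0.
have -> : dl q ^+ n = dl q ^+ m * dl q ^+ (n - m) by rewrite -exprD subnKC.
rewrite expr_div_n -exprM.
by field; rewrite expf_neq0.
Qed.

End Main.

Theorem theorem1p10 (R : realType) (p : nat) (hp : prime p)
    (hp12 : p = 5 %[mod 12] \/ p = 11 %[mod 12])
    (n : nat) (a : 'I_3) (b : bool) (hk : weight_decomp p.+1 n a b)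
    (f : R[i] -> R[i]) (hf : is_Ck p.+1 n thetaH f)
    (P : {poly rat}) (hP : is_P_of n a b f P) :
  poly_congr p P (V b n).
Proof.
(* The six values of [4 a + 6 b] are distinct modulo 12, and [p + 1] is 0 or 6 there, which leaves
   only [a = 0]. *)
have [a0 pe p4] : [/\ a = 0 :> nat, p.+1 = 12 * n + 6 * b & 4 < p]%N.
  move: hk hp12 (ltn_ord a) (leq_b1 b); rewrite /weight_decomp.
  by move: (nat_of_ord a) (nat_of_bool b) => a' b' ? ? ? ?; split; lia.
pose h m := hyp_coef b m * 1728%:R ^+ m.
have h0 : h 0%N = 1 by rewrite /h hyp_coef0 expr0 mulr1.
have hrec m : (m < n)%N -> alpha m.+1 * h m.+1 = 1728%:R * beta b m * h m.
  by move=> _; exact: hyp_coef_exp_rec.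
have main := coef_congr (g := fun m => P`_(n - m)) hp p4 pe h0 hrec (theta_P_coef a0 hf hP).
have sP : (size P <= n.+1)%N by case: hP.
(* The coefficient of [j^i] corresponds to the index [m = n - i]; beyond degree [n] both polynomials
   vanish. *)
have coefs i : pmul p (P`_i - (V b n)`_i) /\ pint p (V b n)`_i.
  rewrite coef_V; case: ltnP => [iN|iN].
    split; last by apply: (pint_h hp p4 pe h0 hrec); lia.
    by have := main (n - i)%N (leq_subr _ _); rewrite subKn.
  rewrite nth_default ?(leq_trans sP) // subr0.
  by split; [exact: pmul0|exact: pint0].
split=> i; have [d v] := coefs i.
(* The [p]-integrality of [P] is deduced from that of [V] and the congruence. *)
- apply: pint_denq; rewrite -[P`_i](subrK (V b n)`_i).
  by apply: (pintD hp) => //; exact: pmul_pint.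
- exact: pint_denq.
- exact: pmul_numq.
Qed.
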